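(* The mapping $P$ defined by $P(w)=\delta-w\delta$ for $w\in MW(\mathfrak{G})$ is a bijection from $MW(\mathfrak{G})$ to $PD_0(\mathfrak{G})$.
   Context: Let $\mathfrak{G}$ be a complex semisimple Lie algebra of rank $n$, with a fixed Cartan subalgebra, root system $\Delta$, positive roots $\Delta^+$, and simple roots $\alpha_1,\dots,\alpha_n$. Let $A=(a_{ij})$ be the Cartan matrix. Identify $\alpha_i$ with the standard basis vector $e_i$ of $\mathbb{R}^n$, so that $\Delta\subset\mathbb{R}^n$. Equip $\mathbb{R}^n$ with a (positive definite) inner product $\langle\cdot,\cdot\rangle$ such that $2\langle e_i,e_j\rangle/\langle e_i,e_i\rangle=a_{ij}$ for all $i,j$. Let $\delta\in\mathbb{R}^n$ be the half-sum of all positive roots. $MW(\mathfrak{G})$ denotes the Weyl group of $\mathfrak{G}$ realized as a group of $n\times n$ (integer) matrices with respect to the basis of simple roots, acting on $\mathbb{R}^n$. The primary ellipsoid is $PE(\mathfrak{G})=\{x\in\mathbb{R}^n:\langle x,x-2\delta\rangle=0\}$. For $x\in PE(\mathfrak{G})$ and $i\in\{1,\dots,n\}$, let $h^x_i$ be the (unique) nonzero real number such that $(x_1,\dots,x_i+h^x_i,\dots,x_n)\in PE(\mathfrak{G})$, if such a number exists, and $h^x_i=0$ otherwise. Let $T_i:PE(\mathfrak{G})\to PE(\mathfrak{G})$, $T_i(x)=(x_1,\dots,x_{i-1},x_i+h^x_i,x_{i+1},\dots,x_n)$. These are involutions, and $WPE(\mathfrak{G})$ is the group of bijections of $PE(\mathfrak{G})$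 generated by $T_1,\dots,T_n$. The main orbit $PD_0(\mathfrak{G})$ is the orbit of the origin $0$ under $WPE(\mathfrak{G})$. *)

(* Defs.v *)
From HB Require Import structures.
From mathcomp Require Import all_boot all_order all_algebra.
From mathcomp Require Import sesquilinear.
From mathcomp Require Import boolp classical_sets functions fsbigop reals.
From mathcomp.real_closed Require Import complex.

Set Implicit Arguments.
Unset Strict Implicit.
Unset Printing Implicit Defensive.

Import Order.TTheory GRing.Theory Num.Theory.

Local Open Scope classical_set_scope.
Local Open Scope ring_scope.
Local Open Scope complex_scope.

HB.mixin Record Vector_isLieAlgebra (K : fieldType) (L : Type)
    of Vector K L := {
  lie : L -> L -> L;
  lie_linearl : forall y, linear (lie^~ y);
  lie_linearr : forall x, linear (lie x);
  lie_alternating : forall x, lie x x = 0;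
  lie_jacobi : forall x y z,
    lie x (lie y z) + lie y (lie z x) + lie z (lie x y) = 0
}.

#[short(type="lieAlgebraType")]
HB.structure Definition LieAlgebra (K : fieldType) :=
  { L of Vector_isLieAlgebra K L & Vector K L }.

Section LieTheory.
Context (K : fieldType) (g : lieAlgebraType K).
Implicit Types (U I H : {vspace g}) (x y : g).

Definition lie_ideal I : Prop := forall x y, y \in I -> lie x y \in I.

Definition derived U : {vspace g} :=
  <<[seq lie x y | x <- vbasis U, y <- vbasis U]>>%VS.

Definition solvable_lie U : Prop := exists k, iter k derived U = 0%VS.

Definition semisimple : Prop :=
  forall I, lie_ideal I -> solvable_lie I -> I = 0%VS.

Definition ad_diagonalizable x : Prop :=
  exists2 b : seq g, basis_of fullv b
    & forall y, y \in b -> exists c : K, lie x y = c *: y.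

Definition abelian_lie H : Prop := {in H &, forall x y, lie x y = 0}.

(* The usual definition for semisimple algebras over an algebraically closed
   field of characteristic 0 (Helgason, Hall): a maximal abelian subalgebra, all
   of whose elements are ad-diagonalizable. *)
Definition cartan_subalgebra H : Prop :=
  [/\ abelian_lie H,
      forall U, abelian_lie U -> (H <= U)%VS -> U = H
    & forall x, x \in H -> ad_diagonalizable x].

End LieTheory.

Section Roots.
Context (K : fieldType) (g : lieAlgebraType K) (H : {vspace g}).
Local Notation dualH := 'Hom(subvs_of H, K^o).
Implicit Types (beta lambda : dualH) (h : subvs_of H) (x y : g).

Definition root_space beta : set g :=
  [set x | forall h, lie (vsval h) x = (beta h : K) *: x].

Definition is_root beta : Prop :=
  beta != 0 /\ exists2 x, x != 0 & root_space beta x.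

(* For a root beta, the only element h of [g_beta, g_-beta] with beta h = 2. *)
Definition coroot beta : subvs_of H :=
  xget 0 [set h | beta h = 2 /\
    exists x y, [/\ root_space beta x, root_space (- beta) y
                  & vsval h = lie x y]].

Definition root_reflection beta lambda : dualH :=
  lambda - (lambda (coroot beta) : K) *: beta.

(* Over alpha, the positive roots are those of the form \sum_i alpha_i *+ c i. *)
Definition simple_roots n (alpha : n.-tuple dualH) : Prop :=
  [/\ basis_of fullv alpha,
      forall i, is_root (tnth alpha i)
    & forall beta, is_root beta -> exists c : 'I_n -> nat,
        beta = \sum_i tnth alpha i *+ c i \/
        beta = - \sum_i tnth alpha i *+ c i].

Definition cartan_matrix n (alpha : n.-tuple dualH) : 'M[K]_n :=
  \matrix_(i, j) tnth alpha j (coroot (tnth alpha i)).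

End Roots.

Inductive generated_group (X : Type) (S : set (X -> X)) : set (X -> X) :=
| GenIn f : S f -> generated_group S f
| GenId : generated_group S id
| GenComp f f' :
    generated_group S f -> generated_group S f' -> generated_group S (f \o f')
| GenInv f f' :
    generated_group S f -> cancel f f' -> cancel f' f -> generated_group S f'.

Section Coordinates.
Context (R : realType) (g : lieAlgebraType R[i]) (H : {vspace g}).
Local Notation dualH := 'Hom(subvs_of H, R[i]^o).
Context (n : nat) (alpha : n.-tuple dualH).

(* R^n is sent into the dual of H by mapping the i-th standard basis vector to
   the i-th simple root. *)
Definition of_coord (v : 'cV[R]_n) : dualH :=
  \sum_i (v i 0)%:C *: tnth alpha i.

Definition root_vectors : set 'cV[R]_n := [set v | is_root (of_coord v)].

Definition positive_root_vectors : set 'cV[R]_n :=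
  [set v | root_vectors v /\ forall i, 0 <= v i 0].

Definition half_sum : 'cV[R]_n :=
  2^-1 *: \sum_(v \in positive_root_vectors) v.

Definition weyl_group : set (dualH -> dualH) :=
  generated_group [set s | exists2 beta, is_root beta
                                       & s = root_reflection beta].

(* Matrices of Weyl group elements in the basis alpha: column j holds the
   coordinates of the image of the j-th simple root. *)
Definition MW : set 'M[R]_n :=
  [set w | exists2 f, weyl_group f
         & forall j, f (tnth alpha j) = of_coord (col j w)].

End Coordinates.

Section PrimaryEllipsoid.
Context (R : realType) (n : nat).
Local Notation V := 'cV[R]_n.
Context (ip : {dot V for idfun}) (d : V).

Definition PE : set V := [set x | ip x (x - 2 *: d) = 0].

Local Notation e i := (delta_mx i 0 : V).

(* At most one h qualifies, since x + h *: e i \in PE is a quadratic equation in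
   h with root 0; xget returns 0 when there is none. *)
Definition jump (x : V) (i : 'I_n) : R :=
  xget 0 [set h | h != 0 /\ PE (x + h *: e i)].

Lemma PE_jump (x : PE) (i : 'I_n) : val x + jump (val x) i *: e i \in PE.
Proof.
rewrite /jump; case: xgetP => [h _ [_ PEh]|_]; first exact/mem_set.
by rewrite scale0r addr0; exact: valP.
Qed.

Definition T_PE (i : 'I_n) (x : PE) : PE := SigSub (PE_jump x i).

Definition WPE : set (PE -> PE) := generated_group (range T_PE).

Lemma PE0 : (0 : V) \in PE.
Proof. by apply/mem_set; rewrite /PE/= linear0l. Qed.

Definition PD0 : set V := [set val (f (SigSub PE0)) | f in WPE].

End PrimaryEllipsoid.

(* Main.v *)
Require Import Defs.
From HB Require Import structures.
From mathcomp Require Import all_boot all_order all_algebra.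
From mathcomp Require Import sesquilinear.
From mathcomp Require Import boolp classical_sets functions fsbigop reals.
From mathcomp.real_closed Require Import complex.
From mathcomp Require Import finmap cardinality ring zify.

(** Put [delta = half_sum alpha] and let [s_i] be the orthogonal reflection in
    the hyperplane of [e_i].  The primary ellipsoid is the sphere of centre
    [delta] through [0], and [T_i] moves a point to the other end of a chord of
    direction [e_i], that is [T_i x = delta + s_i (x - delta)].  Hence the main
    orbit consists of the points [delta - s delta], where [s] ranges over the
    words in the [s_i] ([PD0_word]).  Two facts remain: these words are exactly
    the elements of the Weyl group ([MW_word]), and only the identity among them
    fixes [delta] ([dominant_stabilizer]).

    Both are classical for root systems.  Every root is a multiple of the image
    of a simple root under a word, by descent on its height, so every root
    reflection is a word.  The vector [delta] has positive products with the
    simple roots ([positive_sum_dominant]), and the exchange condition then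
    shortens any nonempty word fixing [delta].

    What is needed of the Lie algebra is that its roots form a finite set stable
    under the reflections [b |-> b - b (coroot a) a], with integral values
    [b (coroot a)] and [a (coroot a) = 2] ([root_reflection_root],
    [coroot_self]).  That these reflections are orthogonal follows
    ([pairingE]): a reflection in [v] preserving a finite spanning set is unique,
    because two of them would compose to a transvection of infinite order.

    The root strings come from the representations of [sl2]; the core is the
    existence of coroots, for which semisimplicity means only that there is no
    nonzero solvable ideal.  Let [x] be a root vector for [a] and [y] one for
    [- a].  If [a] vanishes on [lie x y], then so do all weights, since the
    Heisenberg relation has no solution by nilpotent operators; so [lie x y] is
    central, hence [0] ([lie_root_opp_eq0]).  The obstruction to a coroot is thus
    a root vector killed by the whole opposite root space.  Such vectors are
    stable under bracketing with every weight vector ([degenerate_lie]), and they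
    are nilpotent, so by the Engel-Jacobson theorem ([engel]) they span a
    solvable ideal, which is [0]. *)

Set Implicit Arguments.
Unset Strict Implicit.
Unset Printing Implicit Defensive.

Import Order.TTheory GRing.Theory Num.Theory.

Local Open Scope classical_set_scope.
Local Open Scope ring_scope.
Local Open Scope complex_scope.

(** * Linear algebra: progressions and eigencomponents *)

(** How the finiteness of a set of roots enters: a transvection preserving the
    set moves no root. *)
Lemma no_progression (K : numFieldType) (V : lmodType K) (s : seq V) (u v : V) :
  (forall k : nat, u + k%:R *: v \in s) -> v = 0.
Proof.
move=> us; apply: contrapT => /eqP v0.
have inj : injective (fun k : nat => u + k%:R *: v).
  move=> i j /addrI /eqP; rewrite -subr_eq0 -scalerBl scaler_eq0 (negbTE v0) orbF.
  by rewrite subr_eq0 eqr_nat => /eqP.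
have := @uniq_leq_size _ [seq u + k%:R *: v | k <- iota 0 (size s).+1] s.
rewrite map_inj_uniq// iota_uniq size_map size_iota ltnn => /(_ isT) F.
by apply/notF/F => x /mapP[k _ ->].
Qed.

Section Eigencomponents.
Context (K : fieldType) (V : lmodType K) (I : Type) (A : I -> {linear V -> V}).
Context (W : eqType) (ev : W -> I -> K).
Hypothesis ev_sep : forall w w', w != w' -> exists i, ev w i != ev w' i.

Definition weight_vector w x := forall i, A i x = ev w i *: x.

(** Applying [A i - ev w i] removes the component of weight [w] and multiplies
    the others by scalars, nonzero for a suitable [i]; induct on the number of
    weights. With [U] the zero subspace this is the independence of weight
    vectors. *)
Lemma eigencomponents_mem (U : V -> Prop) (u : W -> V) (ws : seq W) :
  (forall c x y, U x -> U y -> U (c *: x + y)) ->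
  (forall i x, U x -> U (A i x)) ->
  uniq ws -> (forall w, weight_vector w (u w)) ->
  U (\sum_(w <- ws) u w) -> forall w, w \in ws -> U (u w).
Proof.
move=> Ulin UA; elim: ws u => [//|w ws IH] u /= /andP[wws uws] uw Uu.
have Utail w' : w' \in ws -> U (u w').
  move=> w'ws.
  have [|i wi] := @ev_sep w' w; first by apply: contraNneq wws => <-.
  have U0 : U 0 by have := Ulin (-1) _ _ Uu Uu; rewrite scaleN1r addNr.
  have Uc : U ((ev w' i - ev w i) *: u w').
    apply: (IH (fun z => (ev z i - ev w i) *: u z)) => //.
      by move=> z j; rewrite linearZ/= uw !scalerA mulrC.
    have := Ulin (- ev w i) _ _ Uu (UA i _ Uu).
    rewrite big_cons [A i _]linearD/= uw scalerDr addrACA scaleNr addNr add0r.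
    rewrite [A i _]linear_sum/= scaler_sumr -big_split/=; congr U.
    by apply: eq_bigr => z _; rewrite uw -scalerDl addrC.
  have := Ulin (ev w' i - ev w i)^-1 _ _ Uc U0.
  by rewrite addr0 scalerA mulVf ?scale1r ?subr_eq0.
move=> w'; rewrite inE => /predU1P[->|]; last exact: Utail.
have U0 : U 0 by have := Ulin (-1) _ _ Uu Uu; rewrite scaleN1r addNr.
have Ut : U (\sum_(z <- ws) u z).
  rewrite big_seq; elim/big_ind: _ => // x y Ux Uy.
  by rewrite -[x]scale1r; exact: Ulin.
have := Ulin (-1) _ _ Ut Uu.
by rewrite big_cons scaleN1r addrCA addNr addr0.
Qed.

(** Grouping the terms by weight gives the distinct weights that
    [eigencomponents_mem] asks for. *)
Lemma weight_sum (s : seq (W * V)) :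
  (forall p, p \in s -> weight_vector p.1 p.2) ->
  exists u : W -> V, (forall w, weight_vector w (u w)) /\
    \sum_(p <- s) p.2 = \sum_(w <- undup (unzip1 s)) u w.
Proof.
move=> sw; exists (fun w => \sum_(p <- s | p.1 == w) p.2); split.
  move=> w i; rewrite linear_sum scaler_sumr big_seq_cond [RHS]big_seq_cond.
  by apply: eq_bigr => p /andP[/sw pw /eqP <-]; rewrite pw.
rewrite (exchange_big_dep xpredT)//= big_seq [RHS]big_seq; apply: eq_bigr => p ps.
rewrite (big_rem p.1) /=; last by rewrite mem_undup map_f.
rewrite eqxx big_seq_cond big_pred0 ?addr0// => w.
rewrite mem_rem_uniq ?undup_uniq// inE eq_sym.
by case: eqP => //= _; rewrite ?andbF.
Qed.

End Eigencomponents.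

(** * Brackets of subspaces and the Engel-Jacobson theorem *)

HB.instance Definition _ (K : fieldType) (g : lieAlgebraType K) (x : g) :=
  GRing.isLinear.Build K g g *:%R (lie x) (lie_linearr x).

Section LieBasics.
Context (K : fieldType) (g : lieAlgebraType K).
Implicit Types (U V W X : {vspace g}) (x y z : g).

Lemma lie_lin1 c x y z : lie (c *: x + y) z = c *: lie x z + lie y z.
Proof. exact: lie_linearl. Qed.

Lemma lie0l x : lie 0 x = 0.
Proof. by have := lie_lin1 (-1) 0 0 x; rewrite !scaleN1r !addNr. Qed.

Lemma lieZl c x y : lie (c *: x) y = c *: lie x y.
Proof. by have := lie_lin1 c x 0 y; rewrite lie0l !addr0. Qed.

Lemma lieDl x y z : lie (x + y) z = lie x z + lie y z.
Proof. by have := lie_lin1 1 x y z; rewrite !scale1r. Qed.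

Lemma lieC x y : lie x y = - lie y x.
Proof.
apply/eqP; rewrite -addr_eq0; apply/eqP.
have := lie_alternating (x + y).
by rewrite lieDl !linearD/= !lie_alternating add0r addr0.
Qed.

Lemma lie_suml I (r : seq I) (F : I -> g) y :
  lie (\sum_(i <- r) F i) y = \sum_(i <- r) lie (F i) y.
Proof. by elim/big_rec2: _ => [|i a b _ <-]; rewrite ?lie0l ?lieDl. Qed.

Lemma lie_derivation x y z : lie x (lie y z) = lie (lie x y) z + lie y (lie x z).
Proof.
have := lie_jacobi x y z; rewrite [lie z (lie x y)]lieC [lie z x]lieC linearN/=.
by move/eqP; rewrite subr_eq add0r subr_eq => /eqP.
Qed.

(** Written so that [bracket U U] is [derived U] by conversion. *)
Definition bracket U V : {vspace g} :=
  <<[seq lie x y | x <- vbasis U, y <- vbasis V]>>%VS.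

Lemma mem_bracket U V x y : x \in U -> y \in V -> lie x y \in bracket U V.
Proof.
move=> /coord_vbasis -> /coord_vbasis ->.
rewrite lie_suml memv_suml// => i _; rewrite linear_sum/= memv_suml// => j _.
rewrite lieZl linearZ/= !memvZ// memv_span//.
by apply/allpairsP; exists ((vbasis U)`_i, (vbasis V)`_j); rewrite !mem_nth ?size_tuple.
Qed.

Lemma bracket_sub U V X :
  (forall x y, x \in U -> y \in V -> lie x y \in X) -> (bracket U V <= X)%VS.
Proof.
move=> UVX; apply/span_subvP => _ /allpairsP[[x y] /= [xU yV ->]].
by apply: UVX; exact: vbasis_mem.
Qed.

Lemma bracketS U U' V V' :
  (U <= U')%VS -> (V <= V')%VS -> (bracket U V <= bracket U' V')%VS.
Proof.
by move=> /subvP UU /subvP VV; apply: bracket_sub => x y /UU ? /VV ?; exact: mem_bracket.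
Qed.

(** All products of [k] operators [ad w], with [w] in [W], vanish: this is
    nilpotency of the associative algebra generated by [ad W]. *)
Definition ad_nilpotent_space W : Prop :=
  exists k, iter k (bracket W) fullv = 0%VS.

Lemma solvable_ad_nilpotent_ideal W :
  lie_ideal W -> ad_nilpotent_space W -> solvable_lie W.
Proof.
move=> WI [k Wk]; exists k; apply/eqP; rewrite -subv0 -Wk; elim: k {Wk} => [|k IH].
  exact: subvf.
rewrite !iterS; apply: bracketS => //.
elim: k {IH} => [|k IH]; first exact: subvv.
rewrite iterS; apply: bracket_sub => x y _ /(subvP IH); exact: WI.
Qed.

Lemma iter_bracketS W k V V' : (V <= V')%VS ->
  (iter k (bracket W) V <= iter k (bracket W) V')%VS.
Proof. by move=> VV'; elim: k => // k IH; rewrite !iterS; exact: bracketS. Qed.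

Lemma span_stable (s : seq g) V (a : g) :
  (forall w, w \in s -> lie a w \in V) -> forall w, w \in <<s>>%VS -> lie a w \in V.
Proof.
move=> sV w /(@coord_span _ _ _ (in_tuple s)) ->.
rewrite linear_sum/= memv_suml// => i _; rewrite linearZ/= memvZ// sV//.
by rewrite mem_nth.
Qed.

(** Each term of the filtration [iter k (bracket W) fullv] is stable under
    [a], which normalises [W]; so [p] brackets with [W + <a>], where
    [ad a ^ p = 0], move one step down the filtration. *)
Lemma ad_nilpotent_space_add W a p :
  ad_nilpotent_space W -> (forall w, w \in W -> lie a w \in W) ->
  (forall x, iter p (lie a) x = 0) -> ad_nilpotent_space (<[a]> + W).
Proof.
move=> [k Wk] aW ap; set F := fun j => iter j (bracket W) fullv.
have Fa j x : x \in F j -> lie a x \in F j.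
  elim: j x => [|j IH] x; first by move=> _; exact: memvf.
  apply: span_stable => _ /allpairsP[[w y] /= [/vbasis_mem wW /vbasis_mem yF ->]].
  by rewrite lie_derivation memvD// mem_bracket// ?aW ?IH.
have FS j : (F j.+1 <= F j)%VS.
  by elim: j => [|j IH]; [exact: subvf|exact: bracketS (subvv _) IH].
pose adF i j := iter i (lfun_img (linfun (lie a))) (F j).
have adFF i j : (adF i j <= F j)%VS.
  elim: i => [|i IH]; first exact: subvv.
  by apply/subvP => _ /memv_imgP[x /(subvP IH) xF ->]; rewrite lfunE/= Fa.
have adFp j : adF p j = 0%VS.
  have adFi i x : x \in adF i j -> exists y, x = iter i (lie a) y.
    elim: i x => [|i IH] x; first by exists x.
    by move=> /memv_imgP[y /IH[z ->] ->]; exists z; rewrite lfunE.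
  by apply/eqP; rewrite -subv0; apply/subvP => x /adFi[y ->]; rewrite ap mem0v.
(* With [i = p] the first summand is [0], which is the announced step. *)
have step i j : (iter i (bracket (<[a]> + W)) (F j) <= adF i j + F j.+1)%VS.
  elim: i => [|i IH]; first exact: addvSl.
  rewrite iterS; apply: bracket_sub => b y /memv_addP[_ /vlineP[c ->] [w wW ->]].
  move=> /(subvP IH) /memv_addP[z zF [t tF ->]].
  rewrite lieDl lieZl !linearD/= -addrA memv_add//.
    by rewrite memvZ//; apply/memv_imgP; exists z; rewrite ?lfunE.
  apply: memvD; first by apply: memvZ; exact: (Fa j.+1).
  apply: memvD; first exact: mem_bracket wW (subvP (adFF i j) _ zF).
  exact: mem_bracket wW (subvP (FS j) _ tF).
exists (k * p)%N; apply/eqP; rewrite -subv0 -Wk.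
elim: k {Wk} => [|k IH]; first by rewrite subvf.
rewrite mulSn iterD; apply: (subv_trans (iter_bracketS _ _ IH)).
by apply: (subv_trans (step p k)); rewrite adFp add0v.
Qed.

Section Engel.
Variable S : g -> Prop.
Hypothesis S_lie : forall x y, S x -> S y -> S (lie x y).
Hypothesis S_nil : forall x, S x -> exists p, forall y, iter p (lie x) y = 0.

(** If every bracketing by [s] of an element of [S] outside [<<s>>] could be
    kept outside, arbitrarily long brackets would be nonzero. *)
Lemma engel_normalizer (s : seq g) x0 :
  (forall x, x \in s -> S x) -> ad_nilpotent_space <<s>> ->
  S x0 -> x0 \notin <<s>>%VS ->
  exists2 a, S a /\ a \notin <<s>>%VS & forall w, w \in s -> lie a w \in <<s>>%VS.
Proof.
move=> sS [k sk] Sx0 x0s; apply: contrapT => noa.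
have [x [_ [xs xk]]] : exists x, S x /\ x \notin <<s>>%VS /\
    x \in iter k (bracket <<s>>) fullv.
  elim: k {sk} => [|k [x [Sx [xs xk]]]]; first by exists x0; rewrite memvf.
  suff [w ws wx] : exists2 w, w \in s & lie w x \notin <<s>>%VS.
    by exists (lie w x); split; [exact/S_lie/Sx/sS|rewrite mem_bracket// memv_span].
  apply: contrapT => now; apply: noa; exists x => // w ws.
  apply: contrapT => /negP wx; apply: now; exists w => //.
  by rewrite lieC memvN.
by move: xk xs; rewrite sk memv0 => /eqP ->; rewrite mem0v.
Qed.

(** Enlarge a family spanning a nilpotent subalgebra, one element of [S] at a
    time; [d] bounds its dimension from below, until [S] is exhausted. *)
Lemma engel : exists s : seq g,
  [/\ forall x, x \in s -> S x, forall x, S x -> x \in <<s>>%VS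
    & ad_nilpotent_space <<s>>].
Proof.
suff H d : exists s : seq g, [/\ forall x, x \in s -> S x,
    forall x y, x \in s -> y \in s -> lie x y \in <<s>>%VS,
    ad_nilpotent_space <<s>>
  & (forall x, S x -> x \in <<s>>%VS) \/ (d <= \dim <<s>>)%N].
  have [s [sS _ sn [|dims]]] := H (\dim {:g}).+1; first by exists s.
  by have := leq_trans dims (dimvS (subvf _)); rewrite ltnn.
elim: d => [|d [s [sS slie snil [Ss|ds]]]].
- exists [::]; split => //; last by right.
  by exists 1; apply/eqP; rewrite -subv0; apply: bracket_sub => x y;
    rewrite span_nil memv0 => /eqP ->; rewrite lie0l mem0v.
- by exists s; split => //; left.
have [/existsNP[x0 /not_implyP[Sx0 /negP x0s]]|] :=
  pselect (~ forall x, S x -> x \in <<s>>%VS); last first.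
  by move=> /contrapT Ss; exists s; split => //; left.
have [a [Sa as_] aw] := engel_normalizer sS snil Sx0 x0s.
exists (a :: s); split.
- by move=> x /predU1P[->|/sS].
- have sub x : x \in <<s>>%VS -> x \in <<a :: s>>%VS.
    by rewrite span_cons; apply: (subvP (addvSr _ _)).
  move=> x y /predU1P[->|xs] /predU1P[->|ys].
  + by rewrite lie_alternating mem0v.
  + exact/sub/aw.
  + by rewrite lieC memvN; exact/sub/aw.
  + exact/sub/slie.
- have [p ap] := S_nil Sa; rewrite span_cons.
  by apply: ad_nilpotent_space_add snil _ ap; exact: span_stable.
- right; rewrite (leq_ltn_trans ds)// ltnNge; apply/negP => le.
  have : <<s>>%VS == <<a :: s>>%VS by rewrite eqEdim le span_cons addvSr.
  by move/eqP => E; rewrite E memv_span ?mem_head in as_.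
Qed.

End Engel.

End LieBasics.

(** * Weight spaces of a Cartan subalgebra *)

Section Weights.
Context (K : numFieldType) (g : lieAlgebraType K) (H : {vspace g}).
Local Notation dualH := 'Hom(subvs_of H, K^o).
Hypothesis hH : cartan_subalgebra H.
Implicit Types (a b c : dualH) (x y v : g).

Lemma root_space_lin a k x y :
  root_space a x -> root_space a y -> root_space a (k *: x + y).
Proof. by move=> ax ay h; rewrite linearP/= ax ay scalerDr !scalerA mulrC. Qed.

Lemma root_space_0 a : root_space a 0.
Proof. by move=> h; rewrite linear0 scaler0. Qed.

Lemma root_spaceZ a k x : root_space a x -> root_space a (k *: x).
Proof. by move=> ax; rewrite -[_ *: _]addr0; exact/root_space_lin/root_space_0. Qed.

Lemma root_space_lie a b x y :
  root_space a x -> root_space b y -> root_space (a + b) (lie x y).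
Proof.
by move=> ax bY h; rewrite lie_derivation ax bY lieZl linearZ/= add_lfunE -scalerDl.
Qed.

Lemma root_space_iter a b x y k :
  root_space a x -> root_space b y -> root_space (b + a *+ k) (iter k (lie x) y).
Proof.
move=> ax bY; elim: k => [|k IH]; first by rewrite mulr0n addr0.
by rewrite mulrS addrCA; exact: root_space_lie.
Qed.

(** A vector centralising [H] spans with [H] an abelian subalgebra, so it belongs
    to [H] by maximality. *)
Lemma root_space0P x : root_space (0 : dualH) x <-> x \in H.
Proof.
have [Hab Hmax _] := hH; split=> [x0|xH h]; last first.
  by rewrite zero_lfunE scale0r; exact: Hab (subvsP h) xH.
have Hx h : h \in H -> lie h x = 0.
  by move=> hH'; have := x0 (vsproj H h); rewrite vsprojK// zero_lfunE scale0r.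
rewrite -(Hmax (<[x]> + H)%VS) ?addvSr//; first exact: subvP (addvSl _ _) _ (memv_line _).
move=> _ _ /memv_addP[_ /vlineP[k ->] [y yH ->]] /memv_addP[_ /vlineP[l ->] [z zH ->]].
rewrite lieDl !linearD/= !lieZl !linearZ/= lie_alternating (Hab y z)// Hx//.
by rewrite [lie x z]lieC Hx// !(scaler0, oppr0, addr0).
Qed.

(** Commuting diagonalisable operators are simultaneously diagonalisable: the
    eigencomponents under [h] of a common eigenvector of [hs] stay in its
    eigenspaces for [hs], because these are stable under [h]. *)
Lemma common_eigenvectors (hs : seq g) : (forall h, h \in hs -> h \in H) ->
  forall v, exists xs : seq g,
    (forall x, x \in xs -> forall h, h \in hs -> exists k : K, lie h x = k *: x) /\
    v = \sum_(x <- xs) x.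
Proof.
have [Hab _ Hdiag] := hH.
elim: hs => [|h hs IH] hsH v; first by exists [:: v]; rewrite big_seq1.
have hs'H h' : h' \in hs -> h' \in H by move=> h'hs; rewrite hsH// inE h'hs orbT.
have [xs [xsE ->]] := IH hs'H v.
elim: xs xsE => [|x xs IHxs] xsE; first by exists [::]; rewrite !big_nil.
have [|zs [zsE zsum]] := IHxs; first by move=> y yxs; apply: xsE; rewrite inE yxs orbT.
have hh : h \in H by rewrite hsH ?mem_head.
have [b bbasis bE] := Hdiag h hh.
have /choice[e be] : forall y, exists k : K, y \in b -> lie h y = k *: y.
  by move=> y; have [/bE[k yk]|_] := boolP (y \in b); [exists k|exists 0].
pose s := [seq (e b`_i, coord (in_tuple b) i x *: b`_i) | i : 'I_(size b)].
have ev_sep (w w' : K) : w != w' -> exists i : unit, w != w' by exists tt.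
have sE p : p \in s -> weight_vector (fun _ : unit => lie h) (fun k _ => k) p.1 p.2.
  move=> /mapP[i _ ->] _ /=; rewrite linearZ/= be ?mem_nth//.
  by rewrite !scalerA mulrC.
have [u [uw usum]] := weight_sum sE.
have xu : x = \sum_(w <- undup (unzip1 s)) u w.
  rewrite -usum /s big_map big_enum/=; apply: (@coord_span _ _ _ (in_tuple b)).
  by rewrite (span_basis bbasis) memvf.
pose U y := forall h', h' \in hs -> forall k : K, lie h' x = k *: x -> lie h' y = k *: y.
have Uu : forall w, w \in undup (unzip1 s) -> U (u w).
  apply: (eigencomponents_mem ev_sep _ _ (undup_uniq _) uw).
  - move=> k y z Uy Uz h' h'hs l xl.
    by rewrite linearP/= (Uy h' h'hs l)// (Uz h' h'hs l)// scalerDr !scalerA mulrC.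
  - move=> _ y Uy h' h'hs l xl; rewrite lie_derivation.
    by rewrite (Hab h' h (hs'H _ h'hs) hh) lie0l add0r (Uy h' h'hs l)// linearZ.
  - by rewrite -xu => h' h'hs k.
exists ([seq u w | w <- undup (unzip1 s)] ++ zs); split; last first.
  by rewrite big_cat/= big_map -xu big_cons zsum.
move=> y; rewrite mem_cat => /orP[/mapP[w ws ->]|/zsE//] h'.
rewrite inE => /predU1P[->|h'hs]; first by exists w; exact: (uw w tt).
have [k xk] := xsE x (mem_head _ _) h' h'hs.
by exists k; exact: Uu xk.
Qed.

Lemma common_eigenvector_weight x :
  (forall h, h \in vbasis H -> exists k : K, lie h x = k *: x) ->
  exists a, root_space a x.
Proof.
have [->|x0] := eqVneq x 0; first by exists 0; exact: root_space_0.
move=> xE; have xH w : w \in H -> lie x w \in <[x]>%VS.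
  rewrite -{1}(span_basis (vbasisP H)); apply: span_stable => h /xE[k hx].
  by rewrite lieC hx memvN memvZ// memv_line.
exists (- linfun (coord [tuple x] ord0 \o lie x \o vsval : subvs_of H -> K^o)) => h.
rewrite opp_lfunE lfunE/= lieC; have /vlineP[k ->] := xH _ (subvsP h).
have x1 : coord [tuple x] ord0 x = 1.
  by rewrite (@coord_free _ _ _ [tuple x] ord0 ord0) ?seq1_free.
by rewrite [coord _ _ _]linearZ/= x1 mulr1 scaleNr.
Qed.

Lemma weight_decomposition v : exists s : seq (dualH * g),
  (forall p, p \in s -> root_space p.1 p.2) /\ v = \sum_(p <- s) p.2.
Proof.
have [xs [xsE ->]] := common_eigenvectors (@vbasis_mem _ _ ^~ H) v.
have /choice[e eE] : forall x, exists a : dualH, x \in xs -> root_space a x.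
  move=> x; have [/xsE/common_eigenvector_weight[a ax]|_] := boolP (x \in xs).
    by exists a.
  by exists 0.
exists [seq (e x, x) | x <- xs]; split; last by rewrite big_map.
by move=> _ /mapP[x xxs ->]; exact: eE.
Qed.

Lemma weight_separation (a b : dualH) : a != b ->
  exists h : subvs_of H, (a h : K) != b h.
Proof. by move=> /lfunPn. Qed.

(** The weights occurring in a decomposition of a basis are the only ones, by
    independence of weight vectors. *)
Lemma finite_weights : exists ws : seq dualH,
  forall a x, x != 0 -> root_space a x -> a \in ws.
Proof.
have /choice[F FE] := weight_decomposition.
exists (flatten [seq unzip1 (F z) | z <- vbasis {:g}]) => a x x0 ax.
apply: contraTT isT => aws.
pose s := flatten [seq [seq (p.1, coord (vbasis {:g}) i x *: p.2) |
  p <- F (vbasis {:g})`_i] | i : 'I_(\dim {:g})].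
have sE p : p \in s -> weight_vector (fun h : subvs_of H => lie (vsval h))
    (fun (a : dualH) h => a h) p.1 p.2.
  move=> /flatten_mapP[i _ /mapP[q qF ->]] h /=.
  exact: root_spaceZ ((FE _).1 _ qF) h.
have [u [uw usum]] := weight_sum sE.
have xu : x = \sum_(w <- undup (unzip1 s)) u w.
  rewrite -usum big_flatten/= big_map big_enum/=.
  rewrite {1}(coord_vbasis (memvf x)); apply: eq_bigr => i _.
  by rewrite big_map/= -scaler_sumr -(FE _).2.
have as_ : a \notin undup (unzip1 s).
  rewrite mem_undup; apply: contraNN aws => /mapP[_ /flatten_mapP[i _ /mapP[q qF ->]] ->].
  apply/flatten_mapP; exists (vbasis {:g})`_i; first by rewrite mem_nth ?size_tuple.
  by apply/mapP; exists q.
(* If [a] did not occur, [- x] would complete [xu] to a vanishing sum of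
   vectors of distinct weights. *)
pose u' w := if w == a then - x else u w.
have : - x == 0.
  rewrite -[- x](_ : u' a = _); last by rewrite /u' eqxx.
  apply/eqP; apply: (eigencomponents_mem weight_separation (U := eq^~ 0)
     (A := fun h => lie (vsval h)) (ws := a :: undup (unzip1 s))).
  - by move=> k y z -> ->; rewrite scaler0 addr0.
  - by move=> h y ->; rewrite linear0.
  - by rewrite /= as_ undup_uniq.
  - rewrite /u' => w; case: eqP => [->|_] h; last exact: uw.
    by rewrite linearN/= ax scalerN.
  - rewrite big_cons {1}/u' eqxx {1}xu addrC; apply/eqP; rewrite subr_eq0; apply/eqP.
    rewrite [LHS]big_seq [RHS]big_seq; apply: eq_bigr => w ws.
    by rewrite /u'; case: eqP ws as_ => // -> ->.
  - exact: mem_head.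
by rewrite oppr_eq0 (negbTE x0).
Qed.

(** Bracketing with [x] shifts weights by [a], and only finitely many occur. *)
Lemma ad_nilpotent_root a x : a != 0 -> root_space a x ->
  exists p, forall y, iter p (lie x) y = 0.
Proof.
have [ws wsE] := finite_weights; move=> a0 ax; exists (size ws) => y.
have [s [sE ->]] := weight_decomposition y.
have iter_lin : linear (iter (size ws) (lie x)).
  by elim: (size ws) => // p IH k u v; rewrite !iterS IH linearP.
suff E p : p \in s -> iter (size ws) (lie x) p.2 = 0.
  elim: s E {sE y} => [|p s IH] E.
    rewrite big_nil; elim: (size ws) => // k /= ->; exact: linear0.
  rewrite big_cons -[p.2]scale1r iter_lin E ?mem_head// IH ?scaler0 ?addr0//.
  by move=> q qs; apply: E; rewrite inE qs orbT.
move=> ps; apply: contrapT => /eqP n0.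
have nz j : (j <= size ws)%N -> iter j (lie x) p.2 != 0.
  move=> jn; apply: contraNneq n0 => j0; rewrite -(subnK jn) iterD j0.
  by elim: (_ - _)%N => // k /= /eqP ->; rewrite linear0.
have inj : injective (fun j => p.1 + a *+ j).
  move=> i j /addrI /eqP; rewrite -!scaler_nat -subr_eq0 -scalerBl scaler_eq0.
  by rewrite (negbTE a0) orbF subr_eq0 eqr_nat => /eqP.
have := @uniq_leq_size _ [seq p.1 + a *+ j | j <- iota 0 (size ws).+1] ws.
rewrite map_inj_uniq// iota_uniq size_map size_iota ltnn => /(_ isT) F.
apply/notF/F => _ /mapP[j jn ->].
apply: wsE (nz j _) (root_space_iter _ ax (sE _ ps)).
by rewrite mem_iota add0n ltnS in jn.
Qed.

Lemma iter_lie0 x k : iter k (lie x) 0 = 0.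
Proof. by elim: k => // k /= ->; exact: linear0. Qed.

Lemma extremal_vector a x v : a != 0 -> root_space a x -> v != 0 ->
  exists2 j, iter j (lie x) v != 0 & lie x (iter j (lie x) v) = 0.
Proof.
move=> a0 ax v0; have [p px] := ad_nilpotent_root a0 ax.
have ex : exists k, iter k (lie x) v == 0 by exists p; rewrite px.
case: (ex_minnP ex) => -[|j] /eqP jv jmin; first by rewrite (jv : v = 0) eqxx in v0.
by exists j => //; apply: contraT => /negPn/jmin; rewrite ltnn.
Qed.

End Weights.

(** * Strings of root vectors *)

Section Strings.
Context (K : numFieldType) (g : lieAlgebraType K) (H : {vspace g}).
Local Notation dualH := 'Hom(subvs_of H, K^o).
Hypothesis hss : semisimple g.
Hypothesis hH : cartan_subalgebra H.
Implicit Types (a b c : dualH) (h : subvs_of H) (x y v : g).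

Lemma weight_addMn a b h k : ((b + a *+ k) h : K) = (b h : K) + (a h : K) *+ k.
Proof. by rewrite add_lfunE -scaler_nat scale_lfunE scaler_nat. Qed.

Lemma lie_iter_extremal a b h x y v k :
  root_space (- a) y -> vsval h = lie x y ->
  root_space b v -> lie x v = 0 ->
  lie x (iter k.+1 (lie y) v) =
    ((b h : K) *+ k.+1 - (a h : K) *+ 'C(k.+1, 2)) *: iter k (lie y) v.
Proof.
move=> ay hE bv xv; elim: k => [|k IH].
  by rewrite /= lie_derivation -hE bv xv linear0 addr0 mulr0n subr0.
rewrite [iter k.+2 _ _]iterS lie_derivation IH -hE (root_space_iter _ ay bv).
rewrite linearZ/= -scalerDl; congr (_ *: _).
rewrite weight_addMn opp_lfunE mulNrn.
have -> : 'C(k.+2, 2) = (k.+1 + 'C(k.+1, 2))%N by rewrite binS bin1 addnC.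
by rewrite [in RHS](mulrnDr _ k.+1) [_ *+ k.+2]mulrS [in RHS]opprD addrACA.
Qed.

(** The last nonzero vector of the string is killed by [y], so the coefficient
    of [lie_iter_extremal] vanishes there. One computation covers both the
    Heisenberg case [a h = 0] and the [sl2] case [a h = 2]. *)
Lemma extremal_weight a b h x y v : a != 0 ->
  root_space (- a) y -> vsval h = lie x y ->
  root_space b v -> v != 0 -> lie x v = 0 ->
  exists2 k, iter k (lie y) v != 0 & (b h : K) *+ 2 = (a h : K) *+ k.
Proof.
move=> a0 ay hE bv v0 xv.
have [|k kv yk] := extremal_vector hH _ ay v0; first by rewrite oppr_eq0.
exists k => //; have := lie_iter_extremal k ay hE bv xv.
rewrite iterS yk linear0 => /esym /eqP; rewrite scaler_eq0 (negbTE kv) orbF.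
rewrite subr_eq0 => /eqP E; apply: (@mulIf _ k.+1%:R); first by rewrite pnatr_eq0.
rewrite !mulr_natr -mulrnAC E -!mulrnA; congr (_ *+ _).
by rewrite muln2 -mul2n -mul_bin_diag bin1 mulnC.
Qed.

Lemma center_eq0 z : (forall y, lie z y = 0) -> z = 0.
Proof.
move=> zC; have : <[z]>%VS = 0%VS.
  apply: hss => [x y /vlineP[k ->]|].
    by rewrite linearZ/= lieC zC oppr0 scaler0 mem0v.
  exists 1; apply/eqP; rewrite -subv0; apply: bracket_sub => x y /vlineP[k ->] _.
  by rewrite lieZl zC scaler0 mem0v.
by move=> zv; apply/eqP; rewrite -memv0 -zv memv_line.
Qed.

(** Every weight occurs at the top of a string, shifted by a multiple of [a]; by
    [extremal_weight] it vanishes on [h], which is therefore central. *)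
Lemma lie_root_opp_eq0 a h x y : a != 0 ->
  root_space a x -> root_space (- a) y -> vsval h = lie x y -> a h = 0 ->
  lie x y = 0.
Proof.
move=> a0 ax ay hE ah0; rewrite -hE; apply: center_eq0 => w.
have [s [sE ->]] := weight_decomposition hH w.
rewrite linear_sum big_seq big1//= => -[b v] /sE /= bv.
have [->|v0] := eqVneq v 0; first by rewrite linear0.
have [j jv xjv] := extremal_vector hH a0 ax v0.
have [k _] := extremal_weight a0 ay hE (root_space_iter j ax bv) jv xjv.
rewrite weight_addMn ah0 !mul0rn addr0 => /eqP.
by rewrite mulrn_eq0/= => /eqP bh0; rewrite bv bh0 scale0r.
Qed.

Definition sl2_triple a x h y :=
  [/\ root_space a x, root_space (- a) y, vsval h = lie x y & a h = 2 :> K].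

Lemma sl2_triple_sym a x h y : sl2_triple a x h y -> sl2_triple (- a) y (- h) x.
Proof.
move=> [ax ay hE ah2]; split; rewrite ?opprK//.
  by rewrite linearN/= hE lieC opprK.
by rewrite opp_lfunE linearN/= opprK.
Qed.

Lemma sl2_triple_neq0 a x h y : sl2_triple a x h y -> a != 0.
Proof.
by move=> [_ _ _ ah2]; apply: contra_eq_neq ah2 => ->; rewrite zero_lfunE eq_sym pnatr_eq0.
Qed.

(** [j] steps lead up to the top of the string of [v], and [k] steps from there
    down to its bottom. The reflected weight lies [k - j] steps below the top, so
    it occurs as soon as [j <= k]. *)
Lemma sl2_string a x h y b v : sl2_triple a x h y -> root_space b v -> v != 0 ->
  exists j k : nat, (b h : K) = k%:R - (2 * j)%:R /\
    ((j <= k)%N -> exists2 v', v' != 0 & root_space (b - (b h : K) *: a) v').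
Proof.
move=> t bv v0; have a0 := sl2_triple_neq0 t; case: t => [ax ay hE ah2].
have [j jv xjv] := extremal_vector hH a0 ax v0.
have bj := root_space_iter j ax bv.
have [k kv] := extremal_weight a0 ay hE bj jv xjv.
rewrite weight_addMn ah2 => E.
have bh : (b h : K) = k%:R - (2 * j)%:R.
  apply/eqP; rewrite eq_sym subr_eq eq_sym mulrnA; apply/eqP.
  apply: (@mulIf _ 2%:R); first by rewrite pnatr_eq0.
  rewrite mulr_natr E mulrC. by rewrite mulr_natr.
exists j, k; split => // jk.
exists (iter (k - j) (lie y) (iter j (lie x) v)).
  by apply: contraNneq kv => E0; rewrite -(subnKC jk) iterD E0 iter_lie0.
have := root_space_iter (k - j) ay bj.
rewrite (_ : _ + _ = b - (b h : K) *: a)//.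
rewrite -addrA; congr (_ + _); rewrite mulNrn -!scaler_nat -scalerBl -scaleNr bh.
congr (_ *: _); rewrite natrB// natrM.
by ring.
Qed.

(** When [j > k] the weight [b h] is negative, and the string going the other
    way, for the opposite triple, reaches the reflected weight. *)
Lemma sl2_reflection a x h y b v : sl2_triple a x h y ->
  root_space b v -> v != 0 ->
  (exists m : int, (b h : K) = m%:~R) /\
  exists2 v', v' != 0 & root_space (b - (b h : K) *: a) v'.
Proof.
move=> t bv v0; have [j [k [bh jk]]] := sl2_string t bv v0; split.
  by exists (k%:Z - (2 * j)%N%:Z); rewrite intrB bh.
have [/jk//|kj] := leqP j k.
have [j' [k' [bh' jk']]] := sl2_string (sl2_triple_sym t) bv v0.
have {jk'} := jk' _; rewrite scalerN [b (- h)]linearN/= scaleNr opprK; apply.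
move: bh'; rewrite linearN/= bh opprB => /eqP.
rewrite subr_eq addrAC eq_sym subr_eq -!natrD eqr_nat => /eqP; lia.
Qed.

(** From [g_(2a)] the lowering operator passes through [H] and [<[y]>], and so
    vanishes too early for the weight [4] of [h]. *)
Lemma sl2_no_double a x h y z : sl2_triple a x h y ->
  root_space (a *+ 2) z -> z = 0.
Proof.
move=> t az; have a0 := sl2_triple_neq0 t; case: t => [ax ay hE ah2].
apply: contrapT => /eqP z0.
have [j jz xjz] := extremal_vector hH a0 ax z0.
have aj := root_space_iter j ax az.
have [k kz E] := extremal_weight a0 ay hE aj jz xjz.
have kE : k = (j.+2 * 2)%N.
  move/eqP: E; rewrite -mulrnDr -[a *+ _]add0r weight_addMn zero_lfunE add0r ah2.
  by rewrite -!mulrnA eqr_nat => /eqP; lia.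
set z' := iter j _ _ in aj kz.
have zH : iter j.+2 (lie y) z' \in H.
  apply/(root_space0P hH); have := root_space_iter j.+2 ay aj.
  by rewrite -mulrnDr mulNrn add2n subrr.
have yz : lie y (iter j.+2 (lie y) z') \in <[y]>%VS.
  apply/vlineP; exists ((a (vsproj H (iter j.+2 (lie y) z')) : K)).
  have := ay (vsproj H (iter j.+2 (lie y) z')); rewrite vsprojK// lieC => /eqP.
  by rewrite eqr_oppLR => /eqP ->; rewrite opp_lfunE scaleNr opprK.
have yz0 : iter j.+4 (lie y) z' = 0.
  by rewrite iterS iterS; have /vlineP[l ->] := yz; rewrite linearZ/= lie_alternating scaler0.
move/eqP: kz; apply; rewrite kE -(subnK (_ : j.+4 <= j.+2 * 2)%N).
  by rewrite iterD yz0 iter_lie0.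
lia.
Qed.

End Strings.

(** * Existence of coroots *)

Section Coroots.
Context (K : numFieldType) (g : lieAlgebraType K) (H : {vspace g}).
Local Notation dualH := 'Hom(subvs_of H, K^o).
Hypothesis hss : semisimple g.
Hypothesis hH : cartan_subalgebra H.
Implicit Types (a b c : dualH) (h : subvs_of H) (x y z v : g).

Lemma sl2_triple_vector_neq0 a x h y : sl2_triple a x h y -> x != 0.
Proof.
move=> [_ _ hE ah2]; apply: contra_eq_neq ah2 => x0.
rewrite (_ : h = 0) ?linear0 1?eq_sym ?pnatr_eq0//.
by apply: val_inj; rewrite /= hE x0 lie0l.
Qed.

(** The reflections [c |-> c - c h a] and [c |-> c - c h (r b)] of the set of
    weights involve the same functional, so they compose to a transvection along
    [a - r b], which [no_progression] shows to be trivial. *)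
Lemma sl2_triples_proportional a b h (r : K) x y x' y' :
  sl2_triple a x h y -> sl2_triple b x' (r *: h) y' -> a = r *: b.
Proof.
move=> t1 t2; have [ax ay hE ah2] := t1; have [bx bY rhE brh2] := t2.
have x0 := sl2_triple_vector_neq0 t1.
have rbh : r * (b h : K) = 2 by rewrite -brh2 linearZ.
have [ws wsE] := finite_weights hH.
suff /eqP : (2 : K) *: (a - r *: b) = 0.
  by rewrite scaler_eq0 pnatr_eq0/= subr_eq0 => /eqP.
apply: (@no_progression _ _ ws a) => k.
suff [v v0 kv] : exists2 v, v != 0 & root_space (a + k%:R *: ((2 : K) *: (a - r *: b))) v.
  exact: wsE v0 kv.
elim: k => [|k [v v0 kv]]; first by exists x; rewrite ?scale0r ?addr0.
have [_ [v1 v10]] := sl2_reflection hH t2 kv v0.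
set l := a + _ => lv1.
have lh : (l h : K) = 2.
  rewrite /l add_lfunE !scale_lfunE add_lfunE opp_lfunE scale_lfunE ah2.
  by rewrite (_ : r *: b h = r * b h)// rbh subrr !scaler0 addr0.
have [_ [v2 v20]] := sl2_reflection hH t1 lv1 v10.
rewrite add_lfunE opp_lfunE scale_lfunE lh [l (r *: h)]linearZ/= lh => lv2.
exists v2 => //; move: lv2; congr (root_space _ _).
rewrite (_ : _ *: b h = r * 2 * b h)// mulrAC rbh.
have -> : 2 - 2 * 2 = - 2 :> K by ring.
rewrite scaleNr opprK -(natr1 k) [(k%:R + 1) *: _]scalerDl scale1r [RHS]addrA.
rewrite -/l scalerBr [LHS]addrAC [RHS]addrA.
by rewrite scalerA mulrC.
Qed.

(** By the previous lemma [a] and [b] are proportional, and the integrality of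
    [2 r] and [2 / r] leaves [b] equal to [a] or [- a] up to a factor [1], [2] or
    [1 / 2]. Each case but [b = a] makes one of [a], [b], [b - a] the double of the root of a
    triple, up to sign, against [sl2_no_double]. *)
Lemma sl2_triples_no_difference a b h (r : K) x y x' y' v :
  sl2_triple a x h y -> sl2_triple b x' (r *: h) y' -> b != a ->
  root_space (b - a) v -> v = 0.
Proof.
move=> t1 t2 ab bav; have rE := sl2_triples_proportional t1 t2.
have [ax _ _ ah2] := t1; have [bx _ _ brh2] := t2.
have x0 := sl2_triple_vector_neq0 t1; have x'0 := sl2_triple_vector_neq0 t2.
have [[m mE] _] := sl2_reflection hH t1 bx x'0.
have [[k kE] _] := sl2_reflection hH t2 ax x0.
have rm : r * m%:~R = 2 by rewrite -mE -brh2 linearZ.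
have kr : (k%:~R : K) = r * 2 by rewrite -kE linearZ/= ah2.
have mk : m * k = 4.
  apply/eqP; rewrite -(eqr_int K) intrM kr mulrA [_ * r]mulrC rm; apply/eqP.
  by rewrite -natrM.
have mab : m%:~R *: a = (2 : K) *: b by rewrite rE scalerA mulrC rm.
have half c c' : (2 : K) *: c = (2 : K) *: c' -> c = c'.
  by apply: scalerI; rewrite pnatr_eq0.
have m1 : m \in [:: 1; -1; 2; -2; 4; -4].
  have m4 : (`|m| <= 4)%N by rewrite dvdn_leq// -[4%N]/`|4 : int|%N -mk abszM dvdn_mulr.
  rewrite !inE; have [m0|m0] := eqVneq m 0; first by rewrite m0 mul0r in mk.
  have [m3|m3] := eqVneq m 3; first by move: mk; rewrite m3; lia.
  have [m3'|m3'] := eqVneq m (-3); first by move: mk; rewrite m3'; lia.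
  lia.
have x_b2 : root_space (b *+ 2) x -> v = 0.
  by move=> b2x; case/eqP: x0; have := sl2_no_double hH t2 b2x.
have x_bN2 : root_space (- b *+ 2) x -> v = 0.
  by move=> b2x; case/eqP: x0; have := sl2_no_double hH (sl2_triple_sym t2) b2x.
have x'_a2 : root_space (a *+ 2) x' -> v = 0.
  by move=> a2x; case/eqP: x'0; have := sl2_no_double hH t1 a2x.
have x'_aN2 : root_space (- a *+ 2) x' -> v = 0.
  by move=> a2x; case/eqP: x'0; have := sl2_no_double hH (sl2_triple_sym t1) a2x.
have four c : 4%:~R *: c = (2 : K) *: (c *+ 2).
  by rewrite -[c *+ 2]scaler_nat scalerA -natrM.
move: mab m1; rewrite !inE => mab.
case/orP=> [/eqP m1|]; [|case/orP=> [/eqP m1|]; [|case/orP=> [/eqP m2|];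
  [|case/orP=> [/eqP m2|]; [|case/orP=> /eqP m4]]]].
- by apply: x_b2; rewrite -scaler_nat -mab m1 scale1r.
- by apply: x_bN2; rewrite mulNrn -scaler_nat -mab m1 mulrNz scaleNr opprK scale1r.
- by move: ab; rewrite m2 in mab; rewrite (half _ _ mab) eqxx.
- have bE : b = - a by apply: half; rewrite -mab m2 mulrNz scaleNr scalerN.
  have := sl2_no_double hH (sl2_triple_sym t1); apply.
  by rewrite mulr2n -[X in X + _]bE.
- by apply: x'_a2; rewrite (_ : a *+ 2 = b)//; apply: half; rewrite -four -mab m4.
- apply: x'_aN2; rewrite (_ : - a *+ 2 = b)//; apply: half.
  by rewrite -mab m4 mulrNz scaleNr four mulNrn scalerN.
Qed.

(** Root vectors from which no [sl2]-triple can be built: the kernel of the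
    pairing of [g_a] with [g_(- a)] given by the bracket. *)
Definition degenerate x := exists a : dualH, [/\ a != 0, root_space a x
  & forall y, root_space (- a) y -> lie x y = 0].

(** Suppose that [b] and [b + a] are nonzero.
    If [y] detected [lie z x], Jacobi would give
    [lie (lie z x) y = lie z (lie x y)], and this nonzero element of [H] would
    carry, up to scalars, [sl2]-triples both for [b] and for [b + a]; their
    difference [a] is a root, which [sl2_triples_no_difference] excludes. *)
Lemma degenerate_lie b z x : root_space b z -> degenerate x -> degenerate (lie z x).
Proof.
move=> bz [a [a0 ax xy0]].
have [ab0|ab0] := eqVneq (b + a) 0.
  have zx0 : lie z x = 0.
    by rewrite lieC xy0 ?oppr0// (addr0_eq (etrans (addrC a b) ab0)).
  by exists a; split; rewrite ?zx0//; [exact: root_space_0|move=> y _; exact: lie0l].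
have bax := root_space_lie bz ax.
exists (b + a); split => // y cy; apply: contrapT => /eqP zxy0.
have zaxy : lie (lie z x) y = lie z (lie x y).
  rewrite [RHS]lie_derivation [X in _ + X]xy0 ?addr0//.
  by have := root_space_lie bz cy; rewrite opprD addrA subrr add0r.
have bxy : root_space (- b) (lie x y).
  by have := root_space_lie ax cy; rewrite opprD addrCA subrr addr0.
have [b0|b0] := eqVneq b 0.
  move: bxy zxy0; rewrite zaxy b0 oppr0 => /(root_space0P hH) h1.
  move: bz; rewrite b0 => /(root_space0P hH) h2.
  by have [Hab _ _] := hH; rewrite Hab// eqxx.
have Hz : lie z (lie x y) \in H.
  by apply/(root_space0P hH); rewrite -(subrr b); exact: root_space_lie.
set h := vsproj H (lie z (lie x y)).
have hE : vsval h = lie z (lie x y) by rewrite vsprojK.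
have [bh cbh] : (b h : K) != 0 /\ ((b + a) h : K) != 0.
  split; apply: contraNneq zxy0 => h0.
    by rewrite zaxy; apply/eqP; exact: (lie_root_opp_eq0 hss hH b0 bz bxy hE h0).
  by apply/eqP; apply: (lie_root_opp_eq0 hss hH ab0 bax cy _ h0); rewrite hE.
have triple c k u w : (c h : K) != 0 -> root_space c u -> root_space (- c) w ->
  vsval h = lie u w -> k = 2 / (c h : K) -> sl2_triple c u (k *: h) (k *: w).
  move=> ch cu cw hu ->; split=> //; first exact: root_spaceZ.
    by rewrite linearZ/= hu linearZ.
  by rewrite linearZ/= -[_ *: _]/(_ * _) divfK.
have t1 := triple _ _ _ _ bh bz bxy hE erefl.
have t2 := triple _ _ _ _ cbh bax cy (etrans hE (esym zaxy)) erefl.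
have hk : 2 / ((b + a) h : K) *: h =
    (b h : K) / ((b + a) h : K) *: (2 / (b h : K) *: h).
  by rewrite scalerA [_ / _ * (2 / _)]mulrC mulrA divfK.
rewrite hk in t2; have x0 : x = 0.
  apply: (sl2_triples_no_difference t1 t2).
    by rewrite -subr_eq0 addrAC subrr add0r.
  by rewrite addrAC subrr add0r.
by case/eqP: zxy0; rewrite x0 linear0 lie0l.
Qed.

Lemma degenerate_eq0 x : degenerate x -> x = 0.
Proof.
have dlie u v : degenerate u -> degenerate v -> degenerate (lie u v).
  by move=> [a [_ au _]]; exact: degenerate_lie.
have dnil u : degenerate u -> exists p, forall y, iter p (lie u) y = 0.
  by move=> [a [a0 au _]]; have := ad_nilpotent_root hH a0 au.
have [s [sd ds sn]] := engel dlie dnil; move=> dx.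
have sI : lie_ideal <<s>>%VS.
  move=> y w; apply: span_stable => {}w ws.
  have [t [tE ->]] := weight_decomposition hH y.
  rewrite lie_suml big_seq memv_suml// => p pt.
  exact: ds (degenerate_lie (tE p pt) (sd w ws)).
have s0 := hss sI (solvable_ad_nilpotent_ideal sI sn).
by apply/eqP; rewrite -memv0 -s0; exact: ds.
Qed.

Lemma exists_sl2_triple a : is_root a -> exists x h y, sl2_triple a x h y.
Proof.
move=> [a0 [x x0 ax]].
have [y ay xy0] : exists2 y, root_space (- a) y & lie x y != 0.
  apply: contrapT => noy; move/eqP: x0; apply; apply: degenerate_eq0.
  exists a; split => // y ay; apply: contrapT => /eqP xy; apply: noy.
  by exists y.
have xyH : lie x y \in H.
  by apply/(root_space0P hH); rewrite -(subrr a); exact: root_space_lie.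
have ah0 : (a (vsproj H (lie x y)) : K) != 0.
  apply: contraNneq xy0 => h0; apply/eqP.
  by apply: (lie_root_opp_eq0 hss hH a0 ax ay _ h0); rewrite vsprojK.
set h := vsproj H _ in ah0; set k := 2 / (a h : K).
exists x, (k *: h), (k *: y); split=> //; first exact: root_spaceZ.
  by rewrite linearZ/= vsprojK// linearZ.
by rewrite linearZ/= -[_ *: _]/(_ * _) divfK.
Qed.

Lemma coroot_sl2_triple a : is_root a -> exists x y, sl2_triple a x (coroot a) y.
Proof.
move=> /exists_sl2_triple [x [h [y [ax ay hE ah2]]]].
rewrite /coroot; case: xgetP => [h' _ [ah2' [x' [y' [ax' ay' hE']]]]|/(_ h)].
  by exists x', y'.
by move=> nh; exfalso; apply: nh; split => //; exists x, y.
Qed.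

Lemma coroot_self a : is_root a -> a (coroot a) = 2 :> K.
Proof. by move=> /coroot_sl2_triple[x [y []]]. Qed.

(** The reflected weight is nonzero: [b = c a] with [c = b (coroot a)] gives
    [c = 2 c] on evaluating at [coroot a]. *)
Lemma root_reflection_root a b : is_root a -> is_root b ->
  (exists m : int, (b (coroot a) : K) = m%:~R) /\ is_root (root_reflection a b).
Proof.
move=> ra [b0 [v v0 bv]]; have [x [y t]] := coroot_sl2_triple ra.
have [bint [v' v'0 v'E]] := sl2_reflection hH t bv v0; split => //.
split; last by exists v'.
apply: contra_neq b0; rewrite /root_reflection => /eqP; rewrite subr_eq0 => /eqP bE.
move: (congr1 (fun f : dualH => (f (coroot a) : K)) bE).
rewrite scale_lfunE coroot_self// -[_ *: _]/(_ * _) => /eqP.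
rewrite -subr_eq0 -[X in X - _]mulr1 -mulrBr mulf_eq0 => /orP[/eqP b0|].
  by rewrite bE b0 scale0r.
by rewrite -[_ - _]opprB oppr_eq0 -[2]/(1 + 1) addrK oner_eq0.
Qed.

End Coroots.

(** * Reflections and abstract root systems *)

Section Reflections.
Context (R : realFieldType) (n : nat) (ip : {dot 'cV[R]_n for idfun}).
Local Notation V := 'cV[R]_n.
Local Notation e i := (delta_mx i 0 : V).
Implicit Types (u v x y : V) (i j k : 'I_n) (l : seq 'I_n).

Lemma ipC u v : ip u v = ip v u.
Proof. by have := hermC ip u v; rewrite expr0 mul1r. Qed.

Lemma ipDl u v x : ip (u + v) x = ip u x + ip v x. Proof. exact: linearDl. Qed.
Lemma ipDr u v x : ip x (u + v) = ip x u + ip x v. Proof. exact: linearDr. Qed.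
Lemma ipNl u v : ip (- u) v = - ip u v. Proof. exact: linearNl. Qed.
Lemma ipNr u v : ip u (- v) = - ip u v. Proof. exact: linearNr. Qed.
Lemma ipZl a u v : ip (a *: u) v = a * ip u v. Proof. exact: linearZl_LR. Qed.
Lemma ipZr a u v : ip u (a *: v) = a * ip u v. Proof. exact: linearZr_LR. Qed.
Lemma ip_gt0 u : u != 0 -> 0 < ip u u. Proof. exact: neq0_dnorm_gt0. Qed.

Lemma coord_sum v : v = \sum_i v i 0 *: e i.
Proof.
apply/matrixP => i j; rewrite (ord1 j) summxE (bigD1 i)//= big1 ?addr0.
  by rewrite !mxE !eqxx mulr1.
by move=> k ki; rewrite !mxE eq_sym (negbTE ki) mulr0.
Qed.

Lemma ip_suml (I : Type) (r : seq I) (F : I -> V) v :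
  ip (\sum_(i <- r) F i) v = \sum_(i <- r) ip (F i) v.
Proof. exact: linear_sumlz. Qed.

Definition reflection v u : V := u - (2 * ip v u / ip v v) *: v.

Lemma reflection_linear v : linear (reflection v).
Proof.
move=> a x y; rewrite /reflection ipDr ipZr scalerBr addrACA; congr (_ + _).
by rewrite -opprD scalerA -scalerDl; congr (- (_ *: _)); ring.
Qed.

HB.instance Definition _ v := GRing.isLinear.Build R V V *:%R (reflection v)
  (reflection_linear v).

Lemma reflection_isometry v x y :
  v != 0 -> ip (reflection v x) (reflection v y) = ip x y.
Proof.
move=> /ip_gt0 /lt0r_neq0 v0.
rewrite /reflection !(ipDl, ipDr, ipNl, ipNr, ipZl, ipZr) (ipC x v).
by field.
Qed.

Lemma reflection_self v : v != 0 -> reflection v v = - v.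
Proof.
move=> /ip_gt0 /lt0r_neq0 v0; rewrite /reflection mulfK//.
by rewrite scaler_nat mulr2n opprD addrA subrr sub0r.
Qed.

Lemma reflectionK v : v != 0 -> involutive (reflection v).
Proof.
move=> v0 x; rewrite {2}/reflection linearB linearZ/= reflection_self//.
by rewrite scalerN opprK /reflection subrK.
Qed.

Lemma reflectionZ a v : a != 0 -> reflection (a *: v) =1 reflection v.
Proof.
move=> a0 x; rewrite /reflection !(ipZl, ipZr) scalerA; congr (_ - _ *: _).
have [->|/ip_gt0 /lt0r_neq0 v0] := eqVneq v 0; first by rewrite linear0l !(mulr0, mul0r).
by field; rewrite a0 v0.
Qed.

Lemma simple_neq0 i : e i != 0.
Proof. by apply/eqP => /matrixP /(_ i 0); rewrite !mxE !eqxx => /eqP; rewrite oner_eq0. Qed.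

Definition word_act l x : V := foldr (fun i => reflection (e i)) x l.

Lemma word_act_linear l : linear (word_act l).
Proof. by move=> a x y; elim: l => //= i l ->; rewrite linearP. Qed.

HB.instance Definition _ l := GRing.isLinear.Build R V V *:%R (word_act l)
  (word_act_linear l).

Lemma word_act_cat l m x : word_act (l ++ m) x = word_act l (word_act m x).
Proof. by rewrite /word_act foldr_cat. Qed.

Lemma word_act_rcons l i x : word_act (rcons l i) x = word_act l (reflection (e i) x).
Proof. by rewrite -cats1 word_act_cat. Qed.

Lemma word_actK l : cancel (word_act l) (word_act (rev l)).
Proof.
move=> x; elim: l x => //= i l IH x.
by rewrite rev_cons word_act_rcons (reflectionK (simple_neq0 i)) IH.
Qed.

Lemma word_actVK l : cancel (word_act (rev l)) (word_act l).
Proof. by move=> x; rewrite -{1}(revK l) word_actK. Qed.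

Lemma word_act_isometry l x y : ip (word_act l x) (word_act l y) = ip x y.
Proof. by elim: l => //= i l IH; rewrite reflection_isometry ?simple_neq0. Qed.

Lemma reflection_word l v x :
  reflection (word_act l v) (word_act l x) = word_act l (reflection v x).
Proof. by rewrite {2}/reflection linearB linearZ/= /reflection !word_act_isometry. Qed.

Lemma reflection_simple_coord i k v : k != i -> reflection (e i) v k 0 = v k 0.
Proof. by move=> ki; rewrite !mxE (negbTE ki) mulr0 oppr0 addr0. Qed.

End Reflections.

(** The facts about the roots of a Lie algebra that the combinatorics of its Weyl
    group rests on. [pairing v] is the functional given by the coroot of [v], so
    that only the pairings of two simple roots are known to come from [ip]; that
    all of them do is proved as [pairingE]. *)
Record root_system (R : realFieldType) (n : nat) (ip : {dot 'cV[R]_n for idfun})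
    (Phi : 'cV[R]_n -> Prop) (pairing : 'cV[R]_n -> 'cV[R]_n -> R) : Prop := {
  rs_finite : exists s : seq 'cV[R]_n, forall v, Phi v -> v \in s;
  rs_simple : forall i, Phi (delta_mx i 0);
  rs_coord : forall v, Phi v -> exists c : 'I_n -> nat,
    (forall i, v i 0 = (c i)%:R) \/ (forall i, v i 0 = - (c i)%:R);
  rs_neq0 : forall v, Phi v -> v != 0;
  rs_linear : forall v, linear (pairing v : 'cV[R]_n -> R^o);
  rs_self : forall v, Phi v -> pairing v v = 2;
  rs_stable : forall v u, Phi v -> Phi u -> Phi (u - pairing v u *: v);
  rs_cartan : forall i j, pairing (delta_mx i 0) (delta_mx j 0) =
    2 * ip (delta_mx i 0) (delta_mx j 0) / ip (delta_mx i 0) (delta_mx i 0)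
}.

Section RootSystem.
Context (R : realFieldType) (n : nat) (ip : {dot 'cV[R]_n for idfun}).
Local Notation V := 'cV[R]_n.
Local Notation e i := (delta_mx i 0 : V).
Local Notation s_ i := (reflection ip (e i)).
Local Notation act := (word_act ip).
Implicit Types (u v x y : V) (i j k : 'I_n) (l m : seq 'I_n).
Context (Phi : V -> Prop) (pairing : V -> V -> R).
Hypothesis rs : root_system ip Phi pairing.

Definition nonneg v := forall i, 0 <= v i 0.

Lemma pairing_linear_ext v u : pairing v u = \sum_i u i 0 * pairing v (e i).
Proof.
pose p : {linear V -> R^o} := HB.pack (pairing v : V -> R^o)
  (GRing.isLinear.Build R V R^o *:%R (pairing v : V -> R^o) (rs_linear rs v)).
have -> : pairing v u = p u by [].
by rewrite {1}(coord_sum u) linear_sum; apply: eq_bigr => i _; rewrite linearZ.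
Qed.

Lemma ip_coord v u : ip v u = \sum_i u i 0 * ip v (e i).
Proof.
rewrite ipC {1}(coord_sum u) ip_suml; apply: eq_bigr => i _.
by rewrite ipZl ipC.
Qed.

Lemma Phi_opp v : Phi v -> Phi (- v).
Proof.
move=> Pv; have := rs_stable rs Pv Pv; rewrite (rs_self rs)//.
by rewrite scaler_nat mulr2n opprD addrA subrr sub0r.
Qed.

Lemma Phi_reflection_simple i v : Phi v -> Phi (s_ i v).
Proof.
move=> Pv; have := rs_stable rs (rs_simple rs i) Pv.
congr (Phi (_ - _ *: _)); rewrite pairing_linear_ext ip_coord mulr_sumr mulr_suml.
by apply: eq_bigr => j _; rewrite (rs_cartan rs); ring.
Qed.

Lemma Phi_word_act l v : Phi v -> Phi (act l v).
Proof. by elim: l => //= i l IH /IH; exact: Phi_reflection_simple. Qed.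

Lemma Phi_sign v : Phi v -> nonneg v \/ nonneg (- v).
Proof.
move=> /(rs_coord rs)[c [cv|cv]]; [left|right] => i; first by rewrite cv ler0n.
by rewrite mxE cv opprK ler0n.
Qed.

Lemma nonneg_neq0_coord v : v != 0 -> nonneg v -> exists i, 0 < v i 0.
Proof.
move=> v0 v_ge0; apply: contrapT => nex; move/eqP: v0; apply.
apply/matrixP => i j; rewrite (ord1 j) mxE; apply/eqP.
by have := v_ge0 i; rewrite le_eqVlt => /predU1P[->//|vi]; case: nex; exists i.
Qed.

(** A simple reflection changes one coordinate only, so a positive root with
    another nonzero coordinate stays positive. *)
Lemma nonneg_reflection_simple i k v : Phi v -> nonneg v -> k != i -> v k 0 != 0 ->
  nonneg (s_ i v).
Proof.
move=> Pv v_ge0 ki vk0; case: (Phi_sign (Phi_reflection_simple i Pv)) => // N.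
have := N k; rewrite mxE reflection_simple_coord// oppr_ge0.
by rewrite leNgt lt0r vk0 v_ge0.
Qed.

Lemma simple_multiple i v : v != 0 -> (forall k, k != i -> v k 0 = 0) ->
  v i 0 != 0 /\ v = v i 0 *: e i.
Proof.
move=> v0 vk0; have vE : v = v i 0 *: e i.
  by rewrite {1}(coord_sum v) (bigD1 i)//= big1 ?addr0// => k /vk0 ->; rewrite scale0r.
by split => //; apply: contra_neq v0 => vi0; rewrite vE vi0 scale0r.
Qed.

Lemma simple_multiple_or i v : v != 0 ->
  (v i 0 != 0 /\ v = v i 0 *: e i) \/ exists2 k, k != i & v k 0 != 0.
Proof.
move=> v0; have [[k ki vk]|nk] := pselect (exists2 k, k != i & v k 0 != 0).
  by right; exists k.
left; apply: simple_multiple => // k ki; apply: contrapT => /eqP vk.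
by apply: nk; exists k.
Qed.

Lemma nonneg_root_height v : Phi v -> nonneg v -> exists m : nat, \sum_i v i 0 = m%:R.
Proof.
move=> Pv v_ge0; have [c [cv|cv]] := rs_coord rs Pv.
  by exists (\sum_i c i)%N; rewrite natr_sum; apply: eq_bigr => j _; rewrite cv.
exists 0%N; apply: big1 => j _; have := v_ge0 j; rewrite cv oppr_ge0 lern0.
by move=> /eqP ->; rewrite oppr0.
Qed.

(** Descent on the sum of the coordinates: some simple root makes an acute angle
    with [v], and reflecting in it lowers that natural number. *)
Lemma nonneg_root_word v : Phi v -> nonneg v ->
  exists l i (a : R), a != 0 /\ v = a *: act l (e i).
Proof.
move=> Pv v_ge0; have [m mE] := nonneg_root_height Pv v_ge0.
have [N mN] := ubnP m; elim: N m v mN mE Pv v_ge0 => // N IH m v mN mE Pv v_ge0.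
have v0 := rs_neq0 rs Pv.
have [i iv] : exists i, 0 < ip (e i) v.
  apply: contrapT => nex; have := ip_gt0 ip v0; rewrite ip_coord ltNge.
  case/negP; apply: sumr_le0 => i _; apply: mulr_ge0_le0; first exact: v_ge0.
  by rewrite ipC leNgt; apply/negP => ?; apply: nex; exists i.
case: (simple_multiple_or i v0) => [[vi0 vE]|[k ki vk]].
  by exists [::], i, (v i 0).
have Psv := Phi_reflection_simple i Pv.
have sv_ge0 := nonneg_reflection_simple Pv v_ge0 ki vk.
have [m' mE'] := nonneg_root_height Psv sv_ge0.
have lt : \sum_j s_ i v j 0 < \sum_j v j 0.
  rewrite (bigD1 i)//= [ltRHS](bigD1 i)//=.
  rewrite (eq_bigr (fun j => v j 0)); last by move=> j; exact: reflection_simple_coord.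
  rewrite ltrD2r !mxE !eqxx mulr1 ltrBlDr ltrDl divr_gt0 ?mulr_gt0//.
  by rewrite ip_gt0 ?simple_neq0.
have [|l [j [a [a0 svE]]]] := IH m' (s_ i v) _ mE' Psv sv_ge0.
  by move: lt; rewrite mE mE' ltr_nat => m'm; exact: leq_trans m'm _.
exists (i :: l), j, a; split => //=.
by rewrite -linearZ/= -svE (reflectionK ip (simple_neq0 _ i)).
Qed.

Lemma root_word v : Phi v -> exists l i (a : R), a != 0 /\ v = a *: act l (e i).
Proof.
move=> Pv; case: (Phi_sign Pv) => [|nv]; first exact: nonneg_root_word.
have [l [i [a [a0 vE]]]] := nonneg_root_word (Phi_opp Pv) nv.
by exists l, i, (- a); rewrite oppr_eq0 scaleNr -vE opprK.
Qed.

Lemma reflection_conj l i a x : a != 0 ->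
  reflection ip (a *: act l (e i)) x = act (l ++ i :: rev l) x.
Proof.
move=> a0; rewrite reflectionZ// word_act_cat /=.
by rewrite -[in LHS](word_actVK ip l x) reflection_word.
Qed.

Lemma root_reflection_word v : Phi v ->
  exists l, forall x, reflection ip v x = act l x.
Proof.
move=> /root_word[l [i [a [a0 ->]]]]; exists (l ++ i :: rev l) => x.
exact: reflection_conj.
Qed.

Lemma Phi_reflection v u : Phi v -> Phi u -> Phi (reflection ip v u).
Proof. by move=> /root_reflection_word[l ->]; exact: Phi_word_act. Qed.

(** Two reflections in [v] preserving [Phi] differ by a transvection; its
    iterates would produce infinitely many roots. *)
Lemma pairingE v u : Phi v -> pairing v u = 2 * ip v u / ip v v.
Proof.
move=> Pv; have v0 := rs_neq0 rs Pv; pose p u := 2 * ip v u / ip v v.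
have pvv : p v = 2 by rewrite /p mulfK// lt0r_neq0// ip_gt0.
have plin a x y : p (a *: x + y) = a * p x + p y.
  by rewrite /p ipDr ipZr; ring.
have qlin a x y : pairing v (a *: x + y) = a * pairing v x + pairing v y.
  exact: rs_linear rs v a x y.
have [roots rootsE] := rs_finite rs.
have agree w : Phi w -> pairing v w = p w.
  move=> Pw; apply/eqP; rewrite -subr_eq0.
  have : (pairing v w - p w) *: v = 0.
    apply: (@no_progression _ _ roots w) => k; apply: rootsE.
    elim: k => [|k IH]; first by rewrite scale0r addr0.
    set w' := _ + _ in IH.
    have diff : pairing v w' - p w' = pairing v w - p w.
      rewrite /w' [w + _]addrC scalerA qlin plin (rs_self rs)// pvv; ring.
    have -> : w + k.+1%:R *: ((pairing v w - p w) *: v) = w' + (pairing v w' - p w') *: v.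
      by rewrite diff /w' -(natr1 k) [(k%:R + 1) *: _]scalerDl scale1r addrA.
    have := Phi_reflection Pv (rs_stable rs Pv IH); congr Phi.
    rewrite /reflection -/(p _) [X in p X]addrC -scaleNr plin pvv.
    by rewrite -addrA; congr (_ + _); rewrite -scaleNr -scalerDl; congr (_ *: _); ring.
  by move/eqP; rewrite scaler_eq0 (negbTE v0) orbF.
rewrite pairing_linear_ext ip_coord mulr_sumr mulr_suml.
by apply: eq_bigr => j _; rewrite (agree _ (rs_simple rs j)) /p; ring.
Qed.

Section Dominant.
Variable d : V.
Hypothesis d_dominant : forall i, 0 < ip d (e i).

Lemma nonneg_ip_gt0 v : v != 0 -> nonneg v -> 0 < ip d v.
Proof.
move=> v0 v_ge0; have [i vi] := nonneg_neq0_coord v0 v_ge0.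
rewrite ip_coord (bigD1 i)//= ltr_pwDl ?mulr_gt0//.
by apply: sumr_ge0 => j _; rewrite mulr_ge0// ltW.
Qed.

(** The signs of [word_act m (e j)], for the suffixes [m] of [l], change
    somewhere. There a simple reflection [s_i] makes a positive root negative, so
    this root is a multiple of [e i], and the letter [i] of [l] cancels
    against [s_ j]. *)
Lemma exchange l j : ip d (act l (e j)) < 0 ->
  exists2 m, size l = (size m).+1 & forall x, act l (s_ j x) = act m x.
Proof.
elim: l => [|i l IH] /= lj; first by have := d_dominant j; rewrite ltNge (ltW lj).
have [l0|l0] := ltP (ip d (act l (e j))) 0.
  have [m lm mE] := IH l0; exists (i :: m) => /=; first by rewrite lm.
  by move=> x; rewrite mE.
exists l => // x; set v := act l (e j) in lj l0.
have Pv : Phi v := Phi_word_act l (rs_simple rs j).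
have v0 := rs_neq0 rs Pv.
have v_ge0 : nonneg v.
  case: (Phi_sign Pv) => // nv; have := nonneg_ip_gt0 (rs_neq0 rs (Phi_opp Pv)) nv.
  by rewrite ipNr oppr_gt0 ltNge l0.
case: (simple_multiple_or i v0) => [[vi0 vE]|[k ki vk]]; last first.
  have sv := nonneg_reflection_simple Pv v_ge0 ki vk.
  have := nonneg_ip_gt0 (rs_neq0 rs (Phi_reflection_simple i Pv)) sv.
  by rewrite ltNge (ltW lj).
rewrite -(reflectionZ _ _ vi0) -vE /v reflection_word.
by rewrite (reflectionK ip (simple_neq0 _ j)).
Qed.

(** If the word ends with [j], the image of [e j] under it has the same product
    with [d] as [e j], so the word without [j] makes [e j] negative; by
    [exchange] the word has the action of one with two letters fewer. *)
Lemma dominant_stabilizer l : act l d = d -> act l =1 id.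
Proof.
have [N] := ubnP (size l); elim: N l => // N IH l.
case/lastP: l => [//|l j] lN; rewrite word_act_rcons => ld.
have [|m lm mE] := @exchange l j.
  have := d_dominant j.
  rewrite -(word_act_isometry ip (rcons l j)) !word_act_rcons ld.
  by rewrite reflection_self ?simple_neq0// linearN/= ipNr oppr_gt0.
rewrite size_rcons ltnS lm in lN.
by move=> x; rewrite word_act_rcons mE; apply: IH; [exact: ltnW|rewrite -mE].
Qed.

End Dominant.

(** Pairing each positive root [v] with [s_ i v] when that is positive too, and
    with itself otherwise, the contributions of each pair to the product with
    [e i] cancel in the first case and are positive in the second. *)
Lemma positive_sum_dominant i :
  0 < ip (\sum_(v \in [set v | Phi v /\ nonneg v]) v) (e i).
Proof.
set Q := [set v | _].
have finQ : finite_set Q.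
  have [roots rootsE] := rs_finite rs.
  apply: (@sub_finite_set _ _ [set` roots]); last exact: finite_seq.
  by move=> v [/rootsE].
rewrite fsbig_finite// ip_suml; set s := fset_set Q.
have sQ v : v \in s = (v \in Q) by rewrite /s in_fset_set.
pose ge0 v := [forall k, 0 <= v k 0].
have ge0P v : reflect (nonneg v) (ge0 v) by exact: forallP.
pose t v := if ge0 (s_ i v) then s_ i v else v.
have sK : involutive (s_ i) := reflectionK ip (simple_neq0 R i).
have tK : {in s, involutive t}.
  move=> v; rewrite sQ => /set_mem[_ /ge0P v_ge0]; rewrite {2}/t.
  by case: ifPn => sv; rewrite /t ?sK ?v_ge0 ?(negbTE sv).
have ts v : v \in s -> t v \in s.
  rewrite !sQ /t => vQ; case: ifPn => // /ge0P sv.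
  by apply/mem_set; split => //; apply: Phi_reflection_simple; case/set_mem: vQ.
have perm : perm_eq (map t s) s.
  have us : uniq (map t s) by rewrite map_inj_in_uniq ?fset_uniq//; exact: can_in_inj tK.
  apply: uniq_perm => //; first exact: fset_uniq.
  move=> v; apply/mapP/idP => [[w ws ->]|vs]; first exact: ts.
  by exists (t v); [exact: ts|rewrite tK].
pose p v := ip v (e i).
have term v : v \in s -> 0 <= p v + p (t v) /\ (v = e i -> 0 < p v + p (t v)).
  rewrite sQ => /set_mem[Pv v_ge0]; rewrite /t; case: ifPn => [/ge0P sv|/ge0P sv].
    have -> : p (s_ i v) = - p v.
      rewrite /p -[X in ip _ X]sK reflection_isometry ?simple_neq0//.
      by rewrite reflection_self ?simple_neq0// ipNr.
    split; rewrite subrr// => vE; have := sv i.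
    by rewrite vE reflection_self ?simple_neq0// !mxE !eqxx oppr_ge0 leNgt ltr01.
  suff : 0 < p v by move=> pv; rewrite addr_ge0 ?addr_gt0 ?ltW.
  have v0 := rs_neq0 rs Pv; rewrite /p.
  case: (simple_multiple_or i v0) => [[vi0 ->]|[k ki vk]].
    by rewrite ipZl mulr_gt0 ?ip_gt0 ?simple_neq0// lt0r vi0 v_ge0.
  by case: sv; exact: nonneg_reflection_simple ki vk.
have eis : e i \in s.
  rewrite sQ; apply/mem_set; split => [|k]; first exact: rs_simple rs i.
  rewrite !mxE.
  by case: (_ && _); rewrite ?ler01.
have sumE : \sum_(v <- s) p v + \sum_(v <- s) p v = \sum_(v <- s) (p v + p (t v)).
  rewrite big_split/=; congr (_ + _).
  by rewrite -(perm_big _ perm) big_map.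
suff : 0 < \sum_(v <- s) p v + \sum_(v <- s) p v by rewrite -mulr2n pmulrn_lgt0.
rewrite sumE (big_rem (e i))//= ltr_pwDl//; first by have [_] := term _ eis; apply.
by rewrite big_seq sumr_ge0// => v /mem_rem /term[].
Qed.

End RootSystem.

(** * The primary ellipsoid *)

Section Ellipsoid.
Context (R : realType) (n : nat) (ip : {dot 'cV[R]_n for idfun}) (d : 'cV[R]_n).
Local Notation V := 'cV[R]_n.
Local Notation e i := (delta_mx i 0 : V).
Local Notation E := (PE ip d).

(** Completing the square. *)
Lemma PE_sphere x : E x <-> ip (x - d) (x - d) = ip d d.
Proof.
have E0 : ip x (x - 2 *: d) = ip (x - d) (x - d) - ip d d.
  by rewrite !(ipDl, ipDr, ipNl, ipNr, ipZr) (ipC _ d x); ring.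
by rewrite /PE/= E0; split=> [/eqP|->]; rewrite ?subrr// subr_eq0 => /eqP.
Qed.

(** The chord of the sphere in direction [e i] is the reflection in the
    hyperplane orthogonal to [e i] through the centre. *)
Lemma jump_reflection x i : E x ->
  x + jump ip d x i *: e i = d + reflection ip (e i) (x - d).
Proof.
move=> Ex; have e0 := lt0r_neq0 (ip_gt0 ip (simple_neq0 R i)).
pose c := 2 * ip (e i) (x - d) / ip (e i) (e i).
rewrite /reflection -/c addrA [d + _]addrC subrK -scaleNr; congr (_ + _ *: _).
have Eh h : E (x + h *: e i) <-> h * (2 * ip (e i) (x - d) + h * ip (e i) (e i)) = 0.
  rewrite PE_sphere; move/PE_sphere: Ex => <-.
  rewrite addrAC -/(x - d) !(ipDl _ _ (h *: _), ipDr _ _ (h *: _)) !(ipZl, ipZr).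
  rewrite (ipC _ (x - d) (e i)).
  set A := ip (x - d) (x - d); set B := ip (e i) (x - d); set C := ip (e i) (e i).
  have -> : A + h * B + (h * B + h * (h * C)) = A + h * (2 * B + h * C) by ring.
  by split=> [/eqP|->]; rewrite ?addr0// -subr_eq0 addrAC subrr add0r => /eqP.
have cE : 2 * ip (e i) (x - d) = c * ip (e i) (e i) by rewrite /c divfK.
rewrite /jump; case: xgetP => [h _ [h0 /Eh]|nh].
  move/eqP; rewrite mulf_eq0 (negbTE h0) cE -mulrDl mulf_eq0 (negbTE e0) orbF/=.
  by rewrite addrC addr_eq0 => /eqP.
apply/esym/eqP; apply: contrapT => /negP c0; apply: (nh (- c)).
by split => //; apply/Eh; rewrite cE -mulrDl subrr mul0r mulr0.
Qed.

(** Conjugating by the translation to the centre [d] turns [WPE] into the group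
    of words. *)
Lemma WPE_word (f : E -> E) : WPE f ->
  exists l, forall x, val (f x) = d + word_act ip l (val x - d).
Proof.
elim=> [_ [i _ <-]||f1 f2 _ [l1 H1] _ [l2 H2]|f1 f2 _ [l H1] K1 K2].
- by exists [:: i] => x; rewrite /= jump_reflection//; exact/set_mem/valP.
- by exists [::] => x; rewrite /= addrC subrK.
- exists (l1 ++ l2) => x.
  by rewrite /= H1 H2 [d + _ - d]addrAC subrr add0r word_act_cat.
- exists (rev l) => x; have := H1 (f2 x); rewrite K2 => ->.
  by rewrite [d + _ - d]addrAC subrr add0r word_actK addrC subrK.
Qed.

Lemma word_WPE l : exists2 f : E -> E, WPE f &
  forall x, val (f x) = d + word_act ip l (val x - d).
Proof.
elim: l => [|i l [f Wf fE]].
  by exists id; [exact: GenId|move=> x; rewrite /= addrC subrK].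
exists (T_PE i \o f); first by apply: GenComp Wf; apply: GenIn; exists i.
move=> x; rewrite /= jump_reflection; last exact/set_mem/valP.
by rewrite fE [d + _ - d]addrAC subrr add0r.
Qed.

Lemma PD0_word x : PD0 ip d x <-> exists l, x = d - word_act ip l d.
Proof.
split=> [[f /WPE_word[l lE] <-]|[l ->]].
  by exists l; rewrite lE /= sub0r linearN.
have [f Wf fE] := word_WPE l; exists f => //.
by rewrite fE /= sub0r linearN.
Qed.

End Ellipsoid.

(** * The roots of a semisimple Lie algebra as vectors of R^n *)

Section Transfer.
Context (R : realType) (g : lieAlgebraType R[i]) (H : {vspace g}) (n : nat).
Local Notation dualH := 'Hom(subvs_of H, R[i]^o).
Context (alpha : n.-tuple dualH) (ip : {dot 'cV[R]_n for idfun}).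
Hypothesis hss : semisimple g.
Hypothesis hH : cartan_subalgebra H.
Hypothesis halpha : simple_roots alpha.
Hypothesis hip : forall i j : 'I_n,
       (2 * ip (delta_mx i 0) (delta_mx j 0)
          / ip (delta_mx i 0) (delta_mx i 0))%:C = cartan_matrix alpha i j.
Local Notation V := 'cV[R]_n.
Local Notation e i := (delta_mx i 0 : V).
Local Notation phi := (of_coord alpha).
Local Notation Phi := (root_vectors alpha).
Implicit Types (u v w : V) (a b : dualH).

Lemma of_coordP (c : R) u v : phi (c *: u + v) = c%:C *: phi u + phi v.
Proof.
rewrite /of_coord scaler_sumr -big_split/=; apply: eq_bigr => i _.
by rewrite !mxE rmorphD rmorphM/= scalerDl scalerA.
Qed.

Lemma of_coord0 : phi 0 = 0.
Proof. by rewrite /of_coord big1// => i _; rewrite mxE scale0r. Qed.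

Lemma of_coordB u v : phi (u - v) = phi u - phi v.
Proof. by rewrite addrC -scaleN1r of_coordP rmorphN1 scaleN1r addrC. Qed.

Lemma of_coordN v : phi (- v) = - phi v.
Proof. by rewrite -[- v]sub0r of_coordB of_coord0 sub0r. Qed.

Lemma of_coordZ (c : R) v : phi (c *: v) = c%:C *: phi v.
Proof. by rewrite -[c *: v]addr0 of_coordP of_coord0 addr0. Qed.

Lemma of_coord_simple i : phi (e i) = tnth alpha i.
Proof.
rewrite /of_coord (bigD1 i)//= big1 ?addr0 => [|j ji].
  by rewrite !mxE !eqxx scale1r.
by rewrite !mxE (negbTE ji) scale0r.
Qed.

Lemma of_coord_inj : injective phi.
Proof.
have [/basis_free/freeP fr _ _] := halpha.
move=> u v /eqP; rewrite -subr_eq0 -of_coordB => /eqP uv0.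
have {}uv0 : \sum_(i < n) ((u - v) i 0)%:C *: alpha`_i = 0.
  by rewrite -[RHS]uv0; apply: eq_bigr => i _; rewrite (tnth_nth 0).
apply/eqP; rewrite -subr_eq0; apply/eqP/matrixP => i j; rewrite (ord1 j) [RHS]mxE.
by have := fr _ uv0 i => -[].
Qed.

Lemma root_of_coord b : is_root b -> exists v, [/\ b = phi v, Phi v & exists c : 'I_n -> nat,
  (forall i, v i 0 = (c i)%:R) \/ (forall i, v i 0 = - (c i)%:R)].
Proof.
have [_ _ pm] := halpha; move=> rb; have [c cb] := pm _ rb.
pose w : V := \col_i (c i)%:R.
have wE : phi w = \sum_i tnth alpha i *+ c i.
  by apply: eq_bigr => i _; rewrite mxE rmorph_nat scaler_nat.
case: cb => bE; [exists w | exists (- w)].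
  have bw : b = phi w by rewrite wE.
  by split; rewrite /root_vectors/= -?bw//; exists c; left => i; rewrite mxE.
have bw : b = phi (- w) by rewrite of_coordN wE.
by split; rewrite /root_vectors/= -?bw//; exists c; right => i; rewrite !mxE.
Qed.

Lemma root_vectors_coord v : Phi v -> exists c : 'I_n -> nat,
  (forall i, v i 0 = (c i)%:R) \/ (forall i, v i 0 = - (c i)%:R).
Proof. by move=> /root_of_coord[w [/of_coord_inj <-]]. Qed.

Lemma root_vectors_finite : exists s : seq V, forall v, Phi v -> v \in s.
Proof.
have [ws wsE] := finite_weights hH.
have /choice[F FE] : forall b, exists v, (exists u, phi u = b) -> phi v = b.
  by move=> b; have [[v vb]|nv] := pselect (exists u, phi u = b);
    [exists v|exists 0].
exists [seq F b | b <- ws] => v [_ [x x0 vx]]; apply/mapP; exists (phi v).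
  exact: wsE x0 vx.
by apply: of_coord_inj; rewrite FE//; exists v.
Qed.

Lemma root_vectors_simple i : Phi (e i).
Proof. by have [_ rt _] := halpha; rewrite /root_vectors/= of_coord_simple. Qed.

Lemma root_vectors_neq0 v : Phi v -> v != 0.
Proof. by move=> [v0 _]; apply: contra_neq v0 => ->; rewrite of_coord0. Qed.

Definition coroot_pairing v u : R := complex.Re (phi u (coroot (phi v)) : R[i]).

Lemma coroot_pairing_linear v : linear (coroot_pairing v : V -> R^o).
Proof.
move=> c x y; rewrite /coroot_pairing of_coordP add_lfunE scale_lfunE raddfD/=.
congr (_ + _).
by case: (phi x _ : R[i]) => p q; rewrite /= mul0r subr0.
Qed.

(** Integrality on roots makes every coroot real on the whole of R^n. *)
Lemma coroot_pairingE v u : Phi v ->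
  (phi u (coroot (phi v)) : R[i]) = (coroot_pairing v u)%:C.
Proof.
move=> rv; suff [r rE] : exists r : R, (phi u (coroot (phi v)) : R[i]) = r%:C.
  by rewrite /coroot_pairing rE.
have simple i : exists r : R, (phi (e i) (coroot (phi v)) : R[i]) = r%:C.
  have [[m mE] _] := root_reflection_root hss hH rv (root_vectors_simple i).
  by exists m%:~R; rewrite mE rmorph_int.
have [r rE] := choice simple; exists (\sum_i u i 0 * r i).
rewrite {1}/of_coord sum_lfunE rmorph_sum; apply: eq_bigr => i _ /=.
by rewrite scale_lfunE -of_coord_simple rE rmorphM.
Qed.

Lemma coroot_pairing_self v : Phi v -> coroot_pairing v v = 2.
Proof. by move=> rv; rewrite /coroot_pairing coroot_self. Qed.

Lemma root_reflection_of_coord v u : Phi v ->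
  root_reflection (phi v) (phi u) = phi (u - coroot_pairing v u *: v).
Proof. by move=> rv; rewrite /root_reflection coroot_pairingE// of_coordB of_coordZ. Qed.

Lemma root_vectors_pairing v u : Phi v -> Phi u -> Phi (u - coroot_pairing v u *: v).
Proof.
move=> rv ru; have [_] := root_reflection_root hss hH rv ru.
by rewrite root_reflection_of_coord.
Qed.

Lemma coroot_pairing_simple i j :
  coroot_pairing (e i) (e j) = 2 * ip (e i) (e j) / ip (e i) (e i).
Proof.
have := hip i j; rewrite /cartan_matrix mxE -!of_coord_simple.
by rewrite coroot_pairingE; [move=> []|exact: root_vectors_simple].
Qed.

Lemma root_vectors_system : root_system ip Phi coroot_pairing.
Proof.
split; [exact: root_vectors_finite|exact: root_vectors_simple
  |exact: root_vectors_coord|exact: root_vectors_neq0|exact: coroot_pairing_linear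
  |exact: coroot_pairing_self|exact: root_vectors_pairing|exact: coroot_pairing_simple].
Qed.

Lemma root_reflection_ip v u : Phi v ->
  root_reflection (phi v) (phi u) = phi (reflection ip v u).
Proof.
by move=> rv; rewrite root_reflection_of_coord// (pairingE root_vectors_system).
Qed.

Lemma weyl_group_word f : weyl_group f ->
  exists l, forall u, f (phi u) = phi (word_act ip l u).
Proof.
elim=> [_ [b /root_of_coord[v [-> rv _]] ->]||f1 f2 _ [l1 H1] _ [l2 H2]
  |f1 f2 _ [l H1] K1 K2].
- have [l lE] := root_reflection_word root_vectors_system rv.
  by exists l => u; rewrite root_reflection_ip// lE.
- by exists [::].
- by exists (l1 ++ l2) => u; rewrite /= H2 H1 word_act_cat.
- by exists (rev l) => u; rewrite -[in LHS](word_actVK ip l u) -H1 K1.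
Qed.

Lemma word_weyl_group l : exists2 f, weyl_group f &
  forall u, f (phi u) = phi (word_act ip l u).
Proof.
elim: l => [|i l [f Wf fE]]; first by exists id => //; exact: GenId.
exists (root_reflection (phi (e i)) \o f).
  apply: GenComp Wf; apply: GenIn; exists (phi (e i)) => //.
  exact: root_vectors_simple.
by move=> u; rewrite /= fE root_reflection_ip//; exact: root_vectors_simple.
Qed.

Lemma MW_word (w : 'M[R]_n) : MW alpha w <-> exists l, forall u, w *m u = word_act ip l u.
Proof.
split=> [[f /weyl_group_word[l fE] wE]|[l wE]].
  exists l => u; rewrite {1}(coord_sum u) {2}(coord_sum u) mulmx_sumr linear_sum.
  apply: eq_bigr => j _; rewrite -scalemxAr linearZ/= -colE; congr (_ *: _).
  by apply: of_coord_inj; rewrite -wE -fE of_coord_simple.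
have [f Wf fE] := word_weyl_group l; exists f => // j.
by rewrite -of_coord_simple fE colE wE.
Qed.

Lemma word_MW l : exists2 w : 'M[R]_n, MW alpha w & forall u, w *m u = word_act ip l u.
Proof.
pose w : 'M[R]_n := \matrix_(k, j) word_act ip l (e j) k 0.
have wE u : w *m u = word_act ip l u.
  rewrite {1}(coord_sum u) {2}(coord_sum u) mulmx_sumr linear_sum.
  apply: eq_bigr => j _; rewrite -scalemxAr linearZ/= -colE; congr (_ *: _).
  by apply/matrixP => k k'; rewrite (ord1 k') !mxE.
by exists w => //; apply/MW_word; exists l.
Qed.

Lemma half_sum_dominant i : 0 < ip (half_sum alpha) (e i).
Proof.
rewrite /half_sum ipZl mulr_gt0 ?invr_gt0 ?ltr0n//.
exact: (positive_sum_dominant root_vectors_system).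
Qed.

End Transfer.

Theorem theorem3p4 (R : realType) (g : lieAlgebraType R[i]) (H : {vspace g})
    (n : nat) (alpha : n.-tuple 'Hom(subvs_of H, R[i]^o))
    (ip : {dot 'cV[R]_n for idfun})
    (hss : semisimple g) (hH : cartan_subalgebra H) (hn : \dim H = n)
    (halpha : simple_roots alpha)
    (hip : forall i j : 'I_n,
       (2 * ip (delta_mx i 0) (delta_mx j 0)
          / ip (delta_mx i 0) (delta_mx i 0))%:C = cartan_matrix alpha i j) :
  set_bij (MW alpha) (PD0 ip (half_sum alpha))
    (fun w : 'M[R]_n => half_sum alpha - w *m half_sum alpha).
Proof.
have MWE := MW_word hss hH halpha hip.
have wordMW := word_MW hss hH halpha hip.
split.
- by move=> w /MWE[l lE]; apply/PD0_word; exists l; rewrite lE.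
- move=> w w' /set_mem/MWE[l lE] /set_mem/MWE[l' lE'] /addrI/oppr_inj.
  rewrite lE lE' => /(congr1 (word_act ip (rev l))).
  rewrite word_actK -word_act_cat => /esym fixed.
  have {fixed} triv := dominant_stabilizer (root_vectors_system hss hH halpha hip)
    (half_sum_dominant hss hH halpha hip) fixed.
  have ww' (u : 'cV_n) : w *m u = w' *m u.
    by rewrite lE lE' -[RHS](word_actVK ip l) -(word_act_cat ip (rev l)) triv.
  apply/matrixP => k j; have := congr1 (fun c : 'cV_n => c k 0) (ww' (delta_mx j 0)).
  by rewrite -!colE !mxE.
- move=> x /PD0_word[l ->]; have [w Ww wE] := wordMW l.
  by exists w => //; rewrite wE.
Qed.
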